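(* Let $X$ be a real Hilbert space of dimension at least $2$, let $r>0$ and let $\Omega\subseteq X$ be closed and connected. Then the following conditions are equivalent: (i) $\Omega$ is $r$-convex. (ii) The limit $\lim_{\varepsilon\to 0,\ \varepsilon>0}\delta_\Omega(\varepsilon)/\varepsilon^2$ exists (as an extended real number) and is $\geq 1/(8r)$. (iii) $\Omega$ is convex and $\liminf_{\varepsilon\to 0,\ \varepsilon>0}\delta^\circ_{\Omega,x}(\varepsilon)/\varepsilon^2\ge 1/(8r)$ for all $x\in\Omega$.
   Context: $X$ is a real Hilbert space with inner product $\langle\cdot,\cdot\rangle$ and norm $\|\cdot\|$. For $c\in X$ and $\rho>0$, $\overline B(c,\rho)$ is the closed ball of radius $\rho$ centered at $c$, and $\overline B(c,0)=\{c\}$. For $r>0$, a set $\Omega\subseteq X$ is called $r$-convex if for all $x,y\in\Omega$ one has $\bigcap \overline B(c,r)\subseteq\Omega$, where the intersection is over all $c\in X$ with $x,y\in\overline B(c,r)$; the intersection is considered equal to $X$ if no such $c$ exists. For $\Omega\subseteq X$ and $0\le\varepsilon<\infty$, $$\delta_\Omega(\varepsilon)=\sup\{\delta\ge 0 \mid \text{for all } x,y\in\Omega \text{ with } \|x-y\|=\varepsilon: \ \overline B((x+y)/2,\delta)\subseteq\Omega\}.$$ For $x\in\Omega$ and $0\le\varepsilon<\infty$, $$\delta^\circ_{\Omega,x}(\varepsilon)=\sup\{\delta\ge0\mid \text{for all } y\in\Omega,\ v\in X \text{ with } \|v\|=1,\ \|x-y\|=\varepsilon,\ \langle v,x-y\rangle=0: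 \ (x+y)/2+\delta v\in\Omega\}.$$ Suprema are taken in the extended real numbers, with $\sup\emptyset=-\infty$ (and $+\infty$ for unbounded sets). *)

(* Defs.v *)
From HB Require Import structures.
From mathcomp Require Import all_boot all_order all_algebra.
From mathcomp Require Import all_classical all_reals all_analysis.

Set Implicit Arguments.
Unset Strict Implicit.
Unset Printing Implicit Defensive.

Import Order.TTheory GRing.Theory Num.Theory.
Import numFieldNormedType.Exports.

Local Open Scope classical_set_scope.
Local Open Scope ring_scope.

(* [closed_ball c 0] is empty in the library (it is the closure of an open
   ball), whereas [closed_ball_ normr c 0] is the singleton [set c]; the two
   agree for positive radii. *)
Notation cball := (closed_ball_ Num.norm).

Definition dim_ge2 (R : realType) (X : lmodType R) : Prop :=
  exists u v : X, forall a b : R, a *: u + b *: v = 0 -> a = 0 /\ b = 0.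

(* The intersection over an empty family of centers is [setT]. *)
Definition r_convex (R : realType) (X : normedModType R) (r : R)
    (Omega : set X) : Prop :=
  forall x y : X, Omega x -> Omega y ->
    \bigcap_(c in [set c : X | cball c r x /\ cball c r y]) cball c r
      `<=` Omega.

(* [ereal_sup set0 = -oo]. *)
Definition delta_modulus (R : realType) (X : normedModType R)
    (Omega : set X) (eps : R) : \bar R :=
  ereal_sup [set d%:E | d in [set d : R | 0 <= d /\
    forall x y : X, Omega x -> Omega y -> `|x - y| = eps ->
      cball (2^-1 *: (x + y)) d `<=` Omega]].

Definition delta_circ (R : realType) (X : normedModType R)
    (ip : {dot X for idfun}) (Omega : set X) (x : X) (eps : R) : \bar R :=
  ereal_sup [set d%:E | d in [set d : R | 0 <= d /\
    forall y v : X, Omega y -> `|v| = 1 -> `|x - y| = eps ->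
      ip v (x - y) = 0 -> Omega (2^-1 *: (x + y) + d *: v)]].

(* Main.v *)
Require Import Defs.
From HB Require Import structures.
From mathcomp Require Import all_boot all_order all_algebra.
From mathcomp Require Import all_classical all_reals all_analysis.
From mathcomp Require Import ring lra.

Set Implicit Arguments.
Unset Strict Implicit.
Unset Printing Implicit Defensive.

Import Order.TTheory GRing.Theory Num.Theory.
Import numFieldNormedType.Exports.

Local Open Scope classical_set_scope.
Local Open Scope ring_scope.

(** Everything goes through one intermediate property, [capped Omega r]: for
    every chord of Omega, the circular caps that the chord cuts off from discs
    of radius larger than r, on the far side from the centre, lie in Omega.

    From r-convexity to the other conditions. If x and y lie in a ball of
    radius r, the parallelogram identity bounds the distance from its centre to
    the midpoint by r - |x - y|^2 / (8r), so that the ball of radius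
    |x - y|^2 / (8r) around the midpoint lies in every such ball and hence in
    Omega ([ball_of_r_convex]). This bounds both moduli from below.

    From caps to r-convexity ([r_convex_of_capped]). If |x - y| <= 2r, a point
    common to all balls of radius r around x and y lies, in a plane through x
    and y, in the closed cap of radius r over the chord [x, y], which is a limit
    of caps of slightly larger radius. If |x - y| > 2r, caps give a ball of
    radius larger than r in Omega, and such a ball can be enlarged again and
    again, because the caps over its chords, being of smaller radius, protrude
    from it. Thus Omega is the whole space ([ball_growth]). Dimension at
    least 2 enters here, to have directions orthogonal to the chord.

    From the moduli to caps, for convex Omega. Fix a plane and a chord, and slide
    the cap of radius r' > r upwards from below the chord; it stays in Omega for
    a while, and if it is stopped before reaching its final position then its
    arc meets the relative boundary of Omega ([sweep]). At a point where the
    arc touches the boundary, Omega is at most as curved as a circle of radius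
    r', whereas both moduli force it to be more curved. For the ball modulus
    this is immediate: the chord of the arc centred below the touching point has
    a sagitta smaller than the radius of the ball around its midpoint
    ([cap_rises_of_balls]). It is enough that the estimate holds for arbitrarily
    small chord lengths. For the modulus at a point, only chords issuing from the
    touching point x are available. There the unit normal n of the arc supports
    Omega, and the numbers <x - y, n> / |x - y|^2 have an infimum M over y near x; the
    point provided by the modulus for the chord [x, y] has about twice the number
    of y, minus a constant exceeding 1 / (2r'), so M exceeds 1 / (2r'), while points
    of the arc show the contrary ([cap_rises_pointwise]).

    Convexity in condition (ii) follows from connectedness: small chords have
    their midpoints in Omega, and repeatedly replacing each vertex of a polygonal
    chain by the midpoint of its neighbours straightens the chain
    ([convex_of_local_midpoints]). Finally the limit in (ii) exists because, if
    the quotient exceeds b for arbitrarily small epsilon, then Omega is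
    1/(8b)-convex and therefore the quotient is at least b for all small
    epsilon ([limit_of_r_convex], [cvg_of_dichotomy]). *)

(** * Sweeping circular caps in a convex planar set *)

Section Planar.
Context {R : realType}.
Implicit Types (O : R -> R -> Prop) (a r s t j k : R).

Definition planar_convex O := forall s t s' t' l, O s t -> O s' t' ->
  0 <= l <= 1 -> O (l * s + (1 - l) * s') (l * t + (1 - l) * t').

(** All that the sweep needs of closedness; it is inherited by plane sections. *)
Definition vertically_closed O := forall s t,
  (forall e, 0 < e -> exists2 t', `|t - t'| < e & O s t') -> O s t.

(** The part above the horizontal axis of the disc of radius r centred at
    (0, - j): decreasing j moves the cap up. *)
Definition cap r j s t := 0 <= t /\ s ^+ 2 + (t + j) ^+ 2 <= r ^+ 2.

(** If a cap with centre below the axis lies in O, no point of its arc with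
    abscissa between -a and a is on the upper boundary of O. This is the only
    information on the curvature of O that the sweep uses. *)
Definition cap_rises O a r := forall s t j, 0 < j -> `|s| < a -> 0 <= t ->
  s ^+ 2 + (t + j) ^+ 2 = r ^+ 2 -> (forall s' t', cap r j s' t' -> O s' t') ->
  exists2 e, 0 < e & O s (t + e).

Lemma near_gt (T : topologicalType) (f : T -> R) x y :
  {for x, continuous f} -> y < f x -> \forall z \near x, y < f z.
Proof. by move=> fc; apply: (cvgr_gt _ fc). Qed.

Lemma near_lt (T : topologicalType) (f : T -> R) x y :
  {for x, continuous f} -> f x < y -> \forall z \near x, f z < y.
Proof. by move=> fc; apply: (cvgr_lt _ fc). Qed.

Lemma norm_le_sqr s t : 0 <= t -> s ^+ 2 <= t ^+ 2 -> `|s| <= t.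
Proof.
move=> t0 h; rewrite -(@ler_pXn2r _ 2) ?nnegrE ?normr_ge0//.
by rewrite real_normK ?num_real.
Qed.

Lemma norm_lt_sqr s t : 0 <= t -> s ^+ 2 < t ^+ 2 -> `|s| < t.
Proof.
move=> t0 h; rewrite -(@ltr_pXn2r _ 2) ?nnegrE ?normr_ge0//.
by rewrite real_normK ?num_real.
Qed.

Lemma planar_chord O a s : planar_convex O -> O (- a) 0 -> O a 0 -> 0 < a ->
  `|s| <= a -> O s 0.
Proof.
move=> cO Ona Oa a0; rewrite ler_norml => /andP[s1 s2].
have := cO _ _ _ _ ((a + s) / (2 * a)) Oa Ona.
have -> : (a + s) / (2 * a) * a + (1 - (a + s) / (2 * a)) * - a = s.
  by field; lra.
rewrite !mulr0 addr0; apply.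
by rewrite divr_ge0 ?ler_pdivrMr; lra.
Qed.

(** The triangle over the chord from (-a, 0) to (a, 0) with apex (s, t), in the
    form of linear inequalities, which are open conditions on (s', t') as long
    as they are strict. *)
Lemma planar_triangle O a s t s' t' : planar_convex O ->
  O (- a) 0 -> O a 0 -> 0 < a -> O s t -> 0 < t -> 0 <= t' -> t' < t ->
  s' * t - t' * s <= a * (t - t') -> - (a * (t - t')) <= s' * t - t' * s ->
  O s' t'.
Proof.
move=> cO Ona Oa a0 Ost t0 t'0 t't h1 h2.
have tt' : 0 < t - t' by lra.
have h : O ((s' * t - t' * s) / (t - t')) 0.
  apply: (planar_chord cO Ona Oa a0).
  by rewrite ler_norml ler_pdivlMr// ler_pdivrMr// mulNr h1 h2.
have := cO _ _ _ _ (t' / t) Ost h.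
have -> : t' / t * s + (1 - t' / t) * ((s' * t - t' * s) / (t - t')) = s'.
  by field; lra.
have -> : t' / t * t + (1 - t' / t) * 0 = t' by field; lra.
by apply; rewrite divr_ge0 ?ler_pdivrMr; lra.
Qed.

Lemma cap_anti r j j' s t : 0 <= j' -> j' <= j -> cap r j s t -> cap r j' s t.
Proof.
move=> j'0 j'j [t_ge0 h]; split=> //; apply: le_trans h.
by rewrite lerD2l lerXn2r ?nnegrE; lra.
Qed.

(** Let j0 be the infimum of the j >= k whose cap lies in O; its own cap does, by
    closedness. If k < j0, every point of that cap has a point of O strictly
    above it, so by the triangle with the chord as base all nearby points above
    the axis are in O. By compactness a slightly higher cap is in O as well,
    against the choice of j0. *)
Lemma sweep O a k r : planar_convex O -> vertically_closed O ->
  0 < a -> 0 <= k -> 0 < r -> r ^+ 2 = a ^+ 2 + k ^+ 2 ->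
  O (- a) 0 -> O a 0 -> cap_rises O a r ->
  forall s t, cap r k s t -> O s t.
Proof.
move=> cO vO a0 k0 r0 rak Ona Oa up.
have kr : k <= r by apply/(le_trans (ler_norm _))/norm_le_sqr; [lra|rewrite rak; nra].
have chord := planar_chord cO Ona Oa a0.
pose J : set R := [set j | k <= j <= r /\ forall s t, cap r j s t -> O s t].
have Jr : J r.
  split; first by rewrite kr lexx.
  move=> s t [t_ge0 h].
  (* This cap is the single point (0, 0). *)
  have t0 : t = 0 by nra.
  have s0 : s = 0 by apply/eqP; rewrite -sqrf_eq0; apply/eqP; nra.
  by rewrite t0 s0; apply: chord; rewrite normr0 ltW.
have Jlb : lbound J k by move=> j [/andP[]].
have hJ : has_inf J by split; [exists r | exists k].
pose j0 := inf J.
have kj0 : k <= j0 by apply: lb_le_inf => //; exists r.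
have kj02 : k ^+ 2 <= j0 ^+ 2 by rewrite lerXn2r ?nnegrE; lra.
have j0r : j0 <= r by apply: ge_inf => //; exists k.
have Jup j : j0 < j -> j <= r -> forall s t, cap r j s t -> O s t.
  move=> j0j jr s t [t_ge0 h].
  have [j' [/andP[kj' j'r] Oj'] j'j] := inf_lt hJ.1 j0j.
  by apply: Oj'; apply: (@cap_anti _ j); [lra|exact: ltW|].
have Jj0 s t : cap r j0 s t -> O s t.
  move=> [t_ge0 h].
  have [t0|t0] := eqVneq t 0.
    rewrite t0; apply/chord/norm_le_sqr; first lra.
    by rewrite t0 add0r in h; lra.
  have {}t0 : 0 < t by rewrite lt_neqAle eq_sym t0.
  have j0r' : j0 < r by nra.
  apply: vO => e e0.
  pose d := Num.min (Num.min (e / 2) t) (r - j0).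
  have d0 : 0 < d by rewrite !lt_min; apply/andP; split; [apply/andP; split|]; lra.
  have [d1 d2 d3] : [/\ d <= e / 2, d <= t & d <= r - j0].
    by rewrite /d; split; rewrite !ge_min lexx ?orbT.
  exists (t - d); first by rewrite opprB addrC subrK gtr0_norm; lra.
  apply: (Jup (j0 + d)); [lra|lra|split; first lra].
  by have -> : t - d + (j0 + d) = t + j0 by ring.
have [kj|] := ltP k j0; last first.
  by move=> j0k s t; have -> : k = j0 by [lra]; exact: Jj0.
exfalso.
have cK : compact (`[- r, r]%classic `*` `[0, r]%classic).
  by apply: compact_setX; exact: segment_compact.
move/compact_near_coveringP : cK => /(_ R (nbhs j0)
  (fun j (x : R * R) => cap r j x.1 x.2 -> O x.1 x.2) _).
case=> [x Kx|e /= e0 He].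
  have sqc (f : (R * R) * R -> R) p : {for p, continuous f} ->
      {for p, continuous (fun y => f y ^+ 2)}.
    by move=> fc; apply: cvgM.
  have c1 : continuous (fun p : (R * R) * R => p.1.1).
    move=> p; apply: (@cvg_comp _ _ _ fst fst); [exact: cvg_fst|exact: cvg_fst].
  have c2 : continuous (fun p : (R * R) * R => p.1.2).
    move=> p; apply: (@cvg_comp _ _ _ fst snd); [exact: cvg_fst|exact: cvg_snd].
  have [hx|hx] := ltP (r ^+ 2) (x.1 ^+ 2 + (x.2 + j0) ^+ 2).
    have cc : {for (x, j0), continuous (fun p : (R * R) * R =>
        p.1.1 ^+ 2 + (p.1.2 + p.2) ^+ 2)}.
      apply: cvgD; first exact: sqc (c1 _).
      apply: (sqc (fun p : (R * R) * R => p.1.2 + p.2)).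
      apply: (@cvgD _ _ _ _ _ (fun p : (R * R) * R => p.1.2) (fun p => p.2));
        [exact: c2|exact: cvg_snd].
    have := near_gt cc hx.
    by apply: filterS => -[y j] /= hy [_]; rewrite leNgt hy.
  case: x Kx hx => s t /= [Ks]; rewrite /= !in_itv/= => /andP[t_ge0 tr] hx.
  have sa : `|s| < a.
    apply: norm_lt_sqr; first lra.
    have : 0 < (j0 - k) * (j0 + k) by rewrite mulr_gt0; lra.
    have : j0 ^+ 2 <= (t + j0) ^+ 2 by rewrite lerXn2r ?nnegrE; lra.
    lra.
  have [e e0 Oe] : exists2 e, 0 < e & O s (t + e).
    have [hx'|hx'] := ltP (s ^+ 2 + (t + j0) ^+ 2) (r ^+ 2); last first.
      by apply: (up _ _ j0) => //; lra.
    have cc : {for 0, continuous (fun e : R => s ^+ 2 + (t + e + j0) ^+ 2)}.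
      apply: cvgD; first exact: cvg_cst.
      apply: cvgM; (apply: cvgD; last exact: cvg_cst);
      (apply: cvgD; [exact: cvg_cst|exact: cvg_id]).
    have := near_lt cc (y := r ^+ 2).
    rewrite addr0 => /(_ hx') [e /= e0 He].
    exists (e / 2); first lra.
    apply: Jj0; split; first lra.
    by apply/ltW/He => /=; rewrite sub0r normrN gtr0_norm; lra.
  move: sa; rewrite ltr_norml => /andP[sa1 sa2].
  have A1 : \forall y \near ((s, t), j0), y.1.2 < t + e.
    by apply: near_lt (c2 _) _ => /=; lra.
  have cl : {for ((s, t), j0), continuous (fun y : (R * R) * R =>
      y.1.1 * (t + e) - y.1.2 * s - a * (t + e - y.1.2))}.
    apply: cvgB; [apply: cvgB|]; apply: cvgM; try exact: cvg_cst; try exact: c1; try exact: c2.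
    by apply: cvgB; [exact: cvg_cst|exact: c2].
  have cl' : {for ((s, t), j0), continuous (fun y : (R * R) * R =>
      y.1.1 * (t + e) - y.1.2 * s + a * (t + e - y.1.2))}.
    apply: cvgD; [apply: cvgB|]; apply: cvgM; try exact: cvg_cst; try exact: c1; try exact: c2.
    by apply: cvgB; [exact: cvg_cst|exact: c2].
  have A2 := near_lt cl (y := 0).
  have A3 := near_gt cl' (y := 0).
  have {}A2 := A2 ltac:(move=> /=; nra).
  have {}A3 := A3 ltac:(move=> /=; nra).
  near=> y; move=> [y1 _].
  apply: (planar_triangle cO Ona Oa a0 Oe) => //; first lra.
  - by near: y.
  - by rewrite -subr_le0; apply: ltW; near: y.
  - by rewrite -subr_ge0 opprK; apply: ltW; near: y.
have [j [j1 j2 j3]] : exists j, [/\ k <= j, j < j0 & `|j0 - j| < e].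
  exists (Num.max k (j0 - e / 2)); split.
  - by rewrite le_max lexx.
  - by rewrite gt_max kj/=; lra.
  - rewrite ltr_norml; have : j0 - e/2 <= Num.max k (j0 - e / 2) by rewrite le_max lexx orbT.
    have : Num.max k (j0 - e / 2) < j0 by rewrite gt_max kj/=; lra.
    by move=> ? ?; apply/andP; split; lra.
have : J j.
  split; first by apply/andP; split; lra.
  move=> s t cst; apply: (He j j3 (s, t)) => //=.
  case: cst => t_ge0 h; split; rewrite /= in_itv/=.
    by rewrite -ler_norml; apply: norm_le_sqr; [lra|nra].
  rewrite t_ge0/=; apply/(le_trans (ler_norm _))/norm_le_sqr; first lra.
  by have : 0 <= t * j by [rewrite mulr_ge0; lra]; nra.
by move/(ge_inf hJ.2); rewrite -/j0; lra.
Unshelve. all: by end_near.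
Qed.

(** With c > 1/(8r), the ball of radius c e^2 around the midpoint of a chord of
    length e goes beyond the arc of radius r over that chord, whose sagitta is
    about e^2/(8r). The chord is taken with the arc point in question above its
    midpoint; arbitrarily small lengths e suffice. *)
Lemma cap_rises_of_balls O a r c : planar_convex O -> O (- a) 0 -> O a 0 ->
  0 < a -> 0 < r -> 1 < 8 * r * c ->
  (forall d, 0 < d -> exists2 e, 0 < e < d & forall s t s' t' s'' t'',
     O s t -> O s' t' -> (s - s') ^+ 2 + (t - t') ^+ 2 = e ^+ 2 ->
     (s'' - (s + s') / 2) ^+ 2 + (t'' - (t + t') / 2) ^+ 2 <= (c * e ^+ 2) ^+ 2 ->
     O s'' t'') ->
  cap_rises O a r.
Proof.
move=> cO Ona Oa a0 r0 rc frq s t j j0 sa t_ge0 xr Oj.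
have chord := planar_chord cO Ona Oa a0.
have c0 : 0 < c by nra.
(* On the axis the chord itself is used, as the arc may leave the half-plane. *)
have [t0|t0] := eqVneq t 0.
  have [e /andP[e0 e1] He] := frq (a - `|s|) ltac:(lra).
  have ce : 0 < c * e ^+ 2 by rewrite mulr_gt0 ?exprn_gt0.
  exists (c * e ^+ 2) => //; rewrite t0 add0r.
  have h u : `|u| < a - `|s| -> O (s + u) 0.
    by move=> h; apply: chord; have := ler_normD s u; lra.
  apply: (He (s + e / 2) 0 (s - e / 2) 0).
  - by apply: h; rewrite gtr0_norm; lra.
  - by apply: h; rewrite normrN gtr0_norm; lra.
  - by field.
  - have -> : s - (s + e / 2 + (s - e / 2)) / 2 = 0 by [field].
    by rewrite expr0n/= add0r addr0 mul0r subr0.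
have {}t0 : 0 < t by rewrite lt_neqAle eq_sym t0.
(* A constant between 1/(8r) and c, so that c' e^2 exceeds the sagitta and the
   chord at depth c' e^2 below the arc point has both ends inside the disc. *)
pose c' := (c + (8 * r)^-1) / 2.
have r8 : 8 * r * (8 * r)^-1 = 1 by rewrite divff//; lra.
have r80 : 0 < (8 * r)^-1 by rewrite invr_gt0; lra.
have c'0 : 0 < c' by rewrite /c'; lra.
have c'c : c' < c by rewrite /c'; nra.
have rc' : 1 < 8 * r * c' by rewrite /c'; nra.
pose g := 2 * r * c' - 1 / 4.
have g0 : 0 < g by rewrite /g; lra.
pose d := Num.min (Num.min (t / 2) 1) (Num.min (t / (2 * c')) (g / c' ^+ 2)).
have d0 : 0 < d.
  by rewrite !lt_min !divr_gt0 ?exprn_gt0//; lra.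
have [d1 d2 d3 d4] : [/\ d <= t / 2, d <= 1, d <= t / (2 * c') & d <= g / c' ^+ 2].
  by rewrite /d; split; rewrite !ge_min lexx ?orbT.
have [e /andP[e0 ed] He] := frq d d0.
have ee : e ^+ 2 <= e by nra.
have e3 : c' * e ^+ 2 <= t / 2.
  have : e * (2 * c') <= t by rewrite -ler_pdivlMr; lra.
  nra.
have e4 : c' ^+ 2 * e ^+ 2 <= g.
  have : e * c' ^+ 2 <= g by rewrite -ler_pdivlMr ?exprn_gt0//; lra.
  have : 0 < c' ^+ 2 by rewrite exprn_gt0.
  nra.
(* The unit normal (p, q) of the arc. *)
pose p := s / r; pose q := (t + j) / r.
have sE : s = r * p by rewrite /p; field; lra.
have tE : t = r * q - j by rewrite /q; field; lra.
have pq : p ^+ 2 + q ^+ 2 = 1.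
  by rewrite /p /q !expr_div_n -mulrDl xr divff// expf_neq0 ?gt_eqF.
have q0 : 0 < q by apply: divr_gt0 => //; lra.
have e1 : e <= t / 2 by lra.
clear r8 r80 d1 d2 d3 d4 d0 ed; clearbody c' p q.
have p1 : `|p| <= 1 by apply: norm_le_sqr; nra.
have q1 : q <= 1 by apply/(le_trans (ler_norm _))/norm_le_sqr; nra.
move: p1; rewrite ler_norml => /andP[p1 p2].
pose h := c' * e ^+ 2.
have h0 : 0 < h by rewrite mulr_gt0 ?exprn_gt0.
have hin u : u ^+ 2 = e ^+ 2 / 4 -> - (e / 2) <= u <= e / 2 ->
    O ((r - h) * p - u * q) ((r - h) * q + u * p - j).
  move=> u2 /andP[u3 u4]; apply: Oj; split.
    have : - (e / 2) <= u * p by nra.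
    rewrite /h in h0 *; rewrite tE in e3 e1; nra.
  have -> : ((r - h) * p - u * q) ^+ 2 + ((r - h) * q + u * p - j + j) ^+ 2 =
    ((r - h) ^+ 2 + u ^+ 2) * (p ^+ 2 + q ^+ 2) by ring.
  rewrite pq mulr1 u2.
  have -> : (r - h) ^+ 2 + e ^+ 2 / 4 = r ^+ 2 + e ^+ 2 * (c' ^+ 2 * e ^+ 2 - g).
    by rewrite /h /g; field.
  have := sqr_ge0 e; nra.
pose k := (c - c') * e ^+ 2.
have k0 : 0 < k by rewrite /k mulr_gt0 ?exprn_gt0//; lra.
exists k => //.
have /hin H1 : (e / 2) ^+ 2 = e ^+ 2 / 4 by field.
have /hin H2 : (- (e / 2)) ^+ 2 = e ^+ 2 / 4 by field.
have {}H1 := H1 ltac:(apply/andP; split; lra).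
have {}H2 := H2 ltac:(apply/andP; split; lra).
apply: (He _ _ _ _ _ _ H1 H2).
  have -> : e ^+ 2 = e ^+ 2 * (p ^+ 2 + q ^+ 2) by rewrite pq mulr1.
  by field.
have -> : c * e ^+ 2 = h + k by rewrite /h /k; ring.
have -> : (s - ((r - h) * p - e / 2 * q + ((r - h) * p - - (e / 2) * q)) / 2) = h * p.
  by rewrite sE; field.
have -> : (t + k - ((r - h) * q + e / 2 * p - j + ((r - h) * q + - (e / 2) * p - j)) / 2) = h * q + k.
  by rewrite tE; field.
have -> : (h * p) ^+ 2 + (h * q + k) ^+ 2 = h ^+ 2 * (p ^+ 2 + q ^+ 2) + 2 * h * k * q + k ^+ 2.
  by ring.
rewrite pq; have : 0 < h * k by rewrite mulr_gt0.
nra.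
Qed.

(** Near an arc point (s, t) of a cap inside O there are points of O on or above
    the arc, on both sides and depending on the abscissa in a Lipschitz way. The
    maximum with 0 is there because the arc may go below the axis, where the
    chord takes over. *)
Lemma arc_points O a r s t j : planar_convex O -> O (- a) 0 -> O a 0 ->
  0 < a -> 0 < r -> 0 < t + j -> `|s| < a -> 0 <= t ->
  s ^+ 2 + (t + j) ^+ 2 = r ^+ 2 -> (forall s' t', cap r j s' t' -> O s' t') ->
  exists C d, [/\ 0 < C, 0 < d & forall u, `|u| < d -> exists v,
    [/\ (s + u) ^+ 2 + (t + j + v) ^+ 2 = r ^+ 2, 0 <= t + j + v,
        `|v| <= C * `|u| & O (s + u) (Num.max 0 (t + v))]].
Proof.
move=> cO Ona Oa a0 r0 q0 sa t_ge0 xr Oj.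
set q := t + j in q0 xr *.
have ns := normr_ge0 s.
exists ((1 + 2 * `|s|) / q).
exists (Num.min (Num.min 1 (q ^+ 2 / (1 + 2 * `|s|))) (a - `|s|)).
split; first by apply: divr_gt0 => //; lra.
  rewrite !lt_min ltr01/= subr_gt0 sa andbT divr_gt0 ?exprn_gt0//; lra.
move=> u; rewrite !lt_min => /andP[/andP[u1 u2] u3].
have hu : `|u * (u + 2 * s)| <= `|u| * (1 + 2 * `|s|).
  rewrite normrM ler_wpM2l//; have := ler_normD u (2 * s).
  by rewrite normrM (ger0_norm (ler0n _ 2)); lra.
rewrite ltr_pdivlMr in u2; last by lra.
have hr : 0 <= r ^+ 2 - (s + u) ^+ 2.
  have := ler_norm (u * (u + 2 * s)).
  by rewrite -xr; nra.
pose w := Num.sqrt (r ^+ 2 - (s + u) ^+ 2).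
have w0 : 0 <= w by exact: sqrtr_ge0.
have w2 : w ^+ 2 = r ^+ 2 - (s + u) ^+ 2 by exact: sqr_sqrtr.
exists (w - q); have -> : q + (w - q) = w by ring.
have e1 : (s + u) ^+ 2 + w ^+ 2 = r ^+ 2 by rewrite w2; ring.
split => //.
  have eq1 : (w - q) * (w + q) = - (u * (u + 2 * s)).
    rewrite -xr in e1.
    have : (w - q) * (w + q) = (s + u) ^+ 2 + w ^+ 2 - (s + u) ^+ 2 - q ^+ 2 by ring.
    by rewrite e1 => ->; ring.
  rewrite mulrAC ler_pdivlMr//; apply: le_trans (_ : `|w - q| * (w + q) <= _).
    by rewrite ler_wpM2l//; lra.
  have -> : `|w - q| * (w + q) = `|(w - q) * (w + q)|.
    by rewrite normrM [`|w + q|]ger0_norm//; lra.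
  by rewrite eq1 normrN mulrC [_ * `|u|]mulrC in hu *.
have [h|h] := leP (t + (w - q)) 0.
  apply: (planar_chord cO Ona Oa a0).
  by have := ler_normD s u; lra.
by apply: Oj; split; [exact: ltW|have -> : t + (w - q) + j = w by rewrite /q; ring]; rewrite e1.
Qed.

(** If O has no point above the arc point (s, t), then the tangent of the arc
    there supports O: a point (u, v) of O beyond the tangent, joined to a point
    of the arc close to (s, t) on the other side, would give a segment passing
    above (s, t), because the arc deviates from its tangent only to second
    order. *)
Lemma arc_supports O a r s t j : planar_convex O -> O (- a) 0 -> O a 0 ->
  0 < a -> 0 < r -> 0 < t + j -> `|s| < a -> 0 <= t ->
  s ^+ 2 + (t + j) ^+ 2 = r ^+ 2 -> (forall s' t', cap r j s' t' -> O s' t') ->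
  (forall e, 0 < e -> ~ O s (t + e)) ->
  forall u v, O u v -> (u - s) * s + (v - t) * (t + j) <= 0.
Proof.
move=> cO Ona Oa a0 r0 q0 sa t_ge0 xr Oj nup u v Ouv.
have [C [d [C0 d0 arc]]] := arc_points cO Ona Oa a0 r0 q0 sa t_ge0 xr Oj.
set q := t + j in q0 xr arc *.
rewrite leNgt; apply/negP; set W := _ + _ => W0.
have nu := normr_ge0 (u - s); have sqrus := sqr_ge0 (u - s).
have den : 0 < (1 + C ^+ 2) * ((u - s) ^+ 2 + 1).
  by rewrite mulr_gt0//; [have := sqr_ge0 C|]; lra.
(* The segment from the arc point of abscissa s - h (u - s) to (u, v) crosses
   the vertical line through s at height t + (h (v - t) + w) / (1 + h). *)
pose h := Num.min (d / (2 * (`|u - s| + 1))) (W / ((1 + C ^+ 2) * ((u - s) ^+ 2 + 1))).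
have h0 : 0 < h by rewrite lt_min !divr_gt0//; lra.
have [h1 h2] : h <= d / (2 * (`|u - s| + 1)) /\ h <= W / ((1 + C ^+ 2) * ((u - s) ^+ 2 + 1)).
  by rewrite /h !ge_min !lexx orbT.
rewrite !ler_pdivlMr in h1 h2; try lra.
have /arc[w [e1 e2 e3 e4]] : `|- (h * (u - s))| < d.
  by rewrite normrN normrM gtr0_norm//; nra.
have wb : w ^+ 2 <= C ^+ 2 * h ^+ 2 * (u - s) ^+ 2.
  rewrite -(real_normK (num_real w)) -!exprMn -[leRHS]real_normK ?num_real//.
  apply: lerXn2r; rewrite ?nnegrE//.
  by rewrite normrN in e3; rewrite !normrM in e3 *; rewrite -!mulrA (gtr0_norm C0).
have pos : 0 < h * (v - t) + w.
  suff : 0 < 2 * q * (h * (v - t) + w) by rewrite pmulr_rgt0//; lra.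
  have -> : 2 * q * (h * (v - t) + w) = 2 * h * W - h ^+ 2 * (u - s) ^+ 2 - w ^+ 2 +
     ((s - h * (u - s)) ^+ 2 + (q + w) ^+ 2 - (s ^+ 2 + q ^+ 2)) by rewrite /W; ring.
  rewrite e1 xr subrr addr0.
  have : 0 < (1 + C ^+ 2) * h by rewrite mulr_gt0//; have := sqr_ge0 C; lra.
  nra.
pose T := Num.max 0 (t + w).
have Tw : t + w <= T by rewrite le_max lexx orbT.
have h10 : 0 < 1 + h by lra.
have := cO _ _ _ _ (h / (1 + h)) Ouv e4.
have -> : h / (1 + h) * u + (1 - h / (1 + h)) * (s + - (h * (u - s))) = s by field; lra.
have -> : h / (1 + h) * v + (1 - h / (1 + h)) * Num.max 0 (t + w) =
  t + (h * (v - t) + (T - t)) / (1 + h) by rewrite -/T; field; lra.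
move=> H; apply: nup (H _); first by rewrite divr_gt0// (lt_le_trans pos)// lerD2l; lra.
by clear -h0; rewrite divr_ge0 ?ler_pdivrMr; lra.
Qed.

(** The last inequality says that the point is on or outside the circle of the
    arc. *)
Lemma small_arc_point O a r s t j d : planar_convex O -> O (- a) 0 -> O a 0 ->
  0 < a -> 0 < r -> 0 < t + j -> `|s| < a -> 0 <= t ->
  s ^+ 2 + (t + j) ^+ 2 = r ^+ 2 -> (forall s' t', cap r j s' t' -> O s' t') ->
  0 < d -> exists x y e, [/\ O (s + x) (t + y), 0 < e < d, x ^+ 2 + y ^+ 2 = e ^+ 2 &
    - (x * s + y * (t + j)) <= e ^+ 2 / 2].
Proof.
move=> cO Ona Oa a0 r0 q0 sa t_ge0 xr Oj d0.
have [C [d1 [C0 d10 arc]]] := arc_points cO Ona Oa a0 r0 q0 sa t_ge0 xr Oj.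
clear Oj Ona Oa; set q := t + j in q0 xr arc *; clearbody q.
pose u := Num.min (d1 / 2) (d / (2 * (1 + C))).
have u0 : 0 < u by rewrite lt_min !divr_gt0//; lra.
have [u1 u2] : u <= d1 / 2 /\ u <= d / (2 * (1 + C)) by rewrite /u !ge_min !lexx orbT.
rewrite ler_pdivlMr in u2; last lra.
clearbody u.
have /arc[v [e1 e2 e3 e4]] : `|u| < d1 by rewrite gtr0_norm//; lra.
rewrite (gtr0_norm u0) in e3; clear arc.
pose y := Num.max 0 (t + v) - t.
have yv : v <= y by rewrite /y lerBrDl le_max lexx orbT.
have yC : `|y| <= C * u.
  move: e3; rewrite !ler_norml => /andP[e31 e32].
  by apply/andP; rewrite /y; have [h|h] := leP (t + v) 0; split; lra.
have yE : Num.max 0 (t + v) = t + y by rewrite /y; ring.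
rewrite yE in e4; clearbody y.
have Cu0 : 0 < C * u by exact: mulr_gt0.
have y2 : y ^+ 2 <= (C * u) ^+ 2.
  by rewrite -(real_normK (num_real y)) lerXn2r ?nnegrE// ltW.
have u20 : 0 < u ^+ 2 by rewrite exprn_gt0.
have uy0 : 0 < u ^+ 2 + y ^+ 2 by have := sqr_ge0 y; lra.
pose e := Num.sqrt (u ^+ 2 + y ^+ 2).
have e0 : 0 < e by rewrite sqrtr_gt0.
have ee : e ^+ 2 = u ^+ 2 + y ^+ 2 by rewrite sqr_sqrtr// ltW.
clearbody e.
have ed : e < d.
  apply: (le_lt_trans (ler_norm _)); apply: norm_lt_sqr; first exact: ltW.
  apply: le_lt_trans (_ : (u + C * u) ^+ 2 < _).
    by rewrite ee; have := mulr_gt0 u0 Cu0; lra.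
  by rewrite ltr_pXn2r ?nnegrE//; lra.
exists u, y, e; split; rewrite ?e0//.
(* With v in place of y, the point is on the circle and equality holds. *)
have : (q + v) ^+ 2 <= (q + y) ^+ 2 by rewrite lerXn2r ?nnegrE; lra.
lra.
Qed.

(** Separates 1/2 from 4 c r by a b for which the errors of second order at
    distance less than d do not matter. *)
Lemma push_margin c r : 0 < c -> 0 < r -> 1 < 8 * r * c ->
  exists b d, [/\ 1 / 2 < b, 0 < d & forall e, 0 < e < d ->
    c ^+ 2 * e ^+ 2 < 1 / 4 /\ b ^+ 2 <= 16 * c ^+ 2 * (r ^+ 2 - e ^+ 2)].
Proof.
move=> c0 r0 rc.
(* b = 4 c m with m between 1/(8c) and r. *)
pose u := 1 / (8 * c).
have uE : c * u = 1 / 8 by rewrite /u; field; lra.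
have ur : u < r by rewrite ltr_pdivrMr; lra.
have u0 : 0 < u by rewrite divr_gt0//; lra.
clearbody u; pose m := (u + r) / 2.
have mc : 1 / 2 < 4 * c * m by rewrite /m; lra.
have mr : m < r by rewrite /m; lra.
have m0 : 0 < m by rewrite /m; lra.
clearbody m; clear uE ur u0 u.
exists (4 * c * m), (Num.min (1 / (2 * c)) (r - m)); split => //.
  by rewrite lt_min divr_gt0//; lra.
move=> e /andP[e0]; rewrite lt_min => /andP[e1 e2].
rewrite ltr_pdivlMr in e1; last lra.
have ce0 : 0 < c * e by exact: mulr_gt0.
split; first by rewrite -exprMn; nra.
have -> : (4 * c * m) ^+ 2 = 16 * c ^+ 2 * m ^+ 2 by ring.
apply: ler_wpM2l; first by rewrite mulr_ge0 ?sqr_ge0.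
nra.
Qed.

(** The numbers g and g' of a vector Y = (x, y) and of the pushed vector Z, namely
    - <., n> / |.|^2 with n = (s, q): since |Z|^2 is close to |Y|^2 / 4, the
    conclusion says that g' is essentially at most 2 g - b. The push is
    orthogonal to Y, on the side of n. *)
Lemma pushed_midpoint_ratio c r s q x y e g b : 0 < c -> 0 < e -> 0 < b ->
  s ^+ 2 + q ^+ 2 = r ^+ 2 -> x ^+ 2 + y ^+ 2 = e ^+ 2 ->
  g * e ^+ 2 = - (x * s + y * q) -> 0 <= g <= 1 ->
  b ^+ 2 <= 16 * c ^+ 2 * (r ^+ 2 - e ^+ 2) ->
  exists2 k, k ^+ 2 = (c * e) ^+ 2 &
    - ((x / 2 - k * y) * s + (y / 2 + k * x) * q) <= e ^+ 2 * (g / 2 - b / 4).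
Proof.
move=> c0 e0 b0 xr xye gE /andP[g_ge0 g1] er.
(* The component along n of Y rotated by a right angle; its sign decides on
   which side to push. *)
pose w := x * q - y * s.
have w2 : w ^+ 2 = e ^+ 2 * (r ^+ 2 - g ^+ 2 * e ^+ 2).
  have -> : w ^+ 2 = (x ^+ 2 + y ^+ 2) * (s ^+ 2 + q ^+ 2) - (- (x * s + y * q)) ^+ 2.
    by rewrite /w; ring.
  by rewrite xye xr -gE; ring.
have wb : (e * b) ^+ 2 <= (4 * c * w) ^+ 2.
  have -> : (4 * c * w) ^+ 2 = e ^+ 2 * (16 * c ^+ 2 * (r ^+ 2 - g ^+ 2 * e ^+ 2)).
    by rewrite exprMn w2; ring.
  rewrite exprMn ler_wpM2l ?sqr_ge0//; apply: (le_trans er).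
  apply: ler_wpM2l; first by rewrite mulr_ge0 ?sqr_ge0.
  by rewrite lerD2l lerN2 ler_piMl ?sqr_ge0// expr_le1.
have eb0 : 0 < e * b by exact: mulr_gt0.
have nw : e * b <= 4 * c * `|w|.
  have -> : 4 * c * `|w| = `|4 * c * w| by rewrite normrM gtr0_norm// mulr_gt0.
  apply/(le_trans (ler_norm _))/norm_le_sqr => //.
  by rewrite real_normK ?num_real.
have w0 : w != 0.
  by apply/eqP => w0; move: nw; rewrite w0 normr0 mulr0 leNgt eb0.
exists (c * e * Num.sg w); first by rewrite exprMn sqr_sg w0 mulr1.
have -> : - ((x / 2 - c * e * Num.sg w * y) * s + (y / 2 + c * e * Num.sg w * x) * q) =
    - (x * s + y * q) / 2 - c * e * (Num.sg w * w) by rewrite {4}/w; field.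
rewrite -normrEsg -gE.
have : e * (e * b) <= e * (4 * c * `|w|) by rewrite ler_pM2l.
lra.
Qed.

(** Suppose that O has no point above the arc point X = (s, t). Its normal n, of
    length r, then supports O, and the ratios <X - Y, n> / |X - Y|^2 of the
    points Y of O near X have an infimum M >= 0. The arc shows M <= 1/2. The
    hypothesis turns Y of ratio g into the midpoint of X and Y pushed outwards by
    c |X - Y|^2, which is closer to X and whose ratio is at most about
    2 g - 4 c r. As 4 c r > 1/2, taking g close to M gives M > 1/2. *)
Lemma cap_rises_pointwise O a r c : planar_convex O -> O (- a) 0 -> O a 0 ->
  0 < a -> 0 < r -> 1 < 8 * r * c ->
  (forall s t, O s t -> exists2 d, 0 < d & forall x y e b,
     O (s + x) (t + y) -> 0 < e < d -> x ^+ 2 + y ^+ 2 = e ^+ 2 ->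
     b ^+ 2 = (c * e) ^+ 2 -> O (s + (x / 2 - b * y)) (t + (y / 2 + b * x))) ->
  cap_rises O a r.
Proof.
move=> cO Ona Oa a0 r0 rc loc s t j j0 sa t_ge0 xr Oj.
have q0 : 0 < t + j by lra.
apply: contrapT => nup0.
have nup e : 0 < e -> ~ O s (t + e) by move=> e0 Oe; apply: nup0; exists e.
have supp := arc_supports cO Ona Oa a0 r0 q0 sa t_ge0 xr Oj nup.
have arc := small_arc_point cO Ona Oa a0 r0 q0 sa t_ge0 xr Oj.
have Ost : O s t by apply: Oj; split=> //; rewrite xr.
have [d2 d20 {}loc] := loc s t Ost.
clear nup nup0 Oj Ona Oa Ost; set q := t + j in q0 xr arc supp *; clearbody q.
have c0 : 0 < c by nra.
have [be [d1 [be2 d10 small]]] := push_margin c0 r0 rc.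
pose d := Num.min d1 d2.
have d0 : 0 < d by rewrite lt_min d10.
have dd1 : d <= d1 by rewrite ge_min lexx.
have dd2 : d <= d2 by rewrite ge_min lexx orbT.
clearbody d.
pose S : set R := [set g | exists x y e, [/\ O (s + x) (t + y), 0 < e < d,
   x ^+ 2 + y ^+ 2 = e ^+ 2 & g * e ^+ 2 = - (x * s + y * q)]].
have S0 : lbound S 0.
  move=> g [x [y [e [Oxy /andP[e0 _] _ gE]]]].
  have := supp _ _ Oxy; rewrite ![_ + _ - _]addrAC !subrr !add0r => h.
  by rewrite -(pmulr_lge0 _ (exprn_gt0 2 e0)) gE oppr_ge0.
have [g0 Sg0 g02] : exists2 g, S g & g <= 1 / 2.
  have [x [y [e [Oxy ed xye h]]]] := arc d d0.
  have e0 : 0 < e ^+ 2 by rewrite exprn_gt0//; case/andP: ed.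
  exists (- (x * s + y * q) / e ^+ 2).
    by exists x, y, e; split => //; rewrite divfK// gt_eqF.
  by rewrite ler_pdivrMr// mulrAC mul1r; lra.
have hS : has_inf S by split; [exists g0 | exists 0].
pose M := inf S.
have M0 : 0 <= M by apply: lb_le_inf => //; exists g0.
have M12 : M <= 1 / 2 by apply: le_trans g02; apply: ge_inf => //; exists 0.
clear g0 Sg0 g02 arc supp.
pose th := Num.min 1 (be - 1 / 2) / 2.
have th0 : 0 < th by rewrite divr_gt0// lt_min ltr01 subr_gt0.
have th1 : th <= 1 / 2 by rewrite /th ler_pM2r ?invr_gt0// ge_min lexx.
have th2 : th <= (be - 1 / 2) / 2 by rewrite /th ler_pM2r ?invr_gt0// ge_min lexx orbT.
clearbody th.
have [g Sg gM] := inf_adherent th0 hS; rewrite -/M in gM.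
have g_ge0 : 0 <= g by exact: S0.
have g01 : 0 <= g <= 1 by apply/andP; split; lra.
have [x [y [e [Oxy he xye gE]]]] := Sg.
have /andP[e0 ed] := he.
have e20 : 0 < e ^+ 2 by rewrite exprn_gt0.
have [ce er] : c ^+ 2 * e ^+ 2 < 1 / 4 /\ be ^+ 2 <= 16 * c ^+ 2 * (r ^+ 2 - e ^+ 2).
  by apply: small; rewrite e0 (lt_le_trans ed).
have be0 : 0 < be by lra.
have [b b2 zr] := pushed_midpoint_ratio c0 e0 be0 xr xye gE g01 er.
have Oz : O (s + (x / 2 - b * y)) (t + (y / 2 + b * x)).
  by apply: (loc x y e) => //; rewrite e0 (lt_le_trans ed).
have zE : (x / 2 - b * y) ^+ 2 + (y / 2 + b * x) ^+ 2 = e ^+ 2 * (1 / 4 + c ^+ 2 * e ^+ 2).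
  have -> : (x / 2 - b * y) ^+ 2 + (y / 2 + b * x) ^+ 2 = (x ^+ 2 + y ^+ 2) * (1 / 4 + b ^+ 2).
    by field.
  by rewrite xye b2 exprMn.
have cce : 0 <= c ^+ 2 * e ^+ 2 by rewrite mulr_ge0 ?sqr_ge0.
have k0 : 0 < 1 / 4 + c ^+ 2 * e ^+ 2 by rewrite ltr_pwDl// divr_gt0.
pose f := Num.sqrt (e ^+ 2 * (1 / 4 + c ^+ 2 * e ^+ 2)).
have f0 : 0 < f by rewrite sqrtr_gt0 mulr_gt0.
have f2 : f ^+ 2 = e ^+ 2 * (1 / 4 + c ^+ 2 * e ^+ 2) by rewrite sqr_sqrtr// ltW// mulr_gt0.
clearbody f.
have fe : f < e.
  apply: (le_lt_trans (ler_norm _)); apply: norm_lt_sqr; first exact: ltW.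
  by rewrite f2 gtr_pMr//; clear -ce; lra.
have MgZ : M * f ^+ 2 <= - ((x / 2 - b * y) * s + (y / 2 + b * x) * q).
  rewrite -ler_pdivlMr ?exprn_gt0//; apply: ge_inf; first by exists 0.
  exists (x / 2 - b * y), (y / 2 + b * x), f; split=> //.
  - by rewrite f0 (lt_trans fe).
  - by rewrite zE f2.
  - by rewrite divfK// expf_neq0// gt_eqF.
have : e ^+ 2 * (M * (1 / 4)) <= e ^+ 2 * (g / 2 - be / 4).
  apply: le_trans zr; apply: le_trans MgZ; rewrite f2 [leRHS]mulrCA.
  by rewrite ler_pM2l// ler_wpM2l// lerDl.
rewrite ler_pM2l//; clear -gM th2 M12; clearbody M; lra.
Qed.

End Planar.

(** * Plane sections of a set in an inner product space *)

Section Hilbert.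
Context {R : realType} {X : normedModType R} (ip : {dot X for idfun}).
Hypothesis ip_norm : forall u : X, ip u u = `|u| ^+ 2.
Implicit Types (Omega : set X) (x y z m e u v w : X) (a b c d k r s t : R).

(** Convexity with real coefficients, more convenient here than the coefficients
    in [{i01 R}] of [convex_set]; see [convex_setE]. *)
Definition convex_subset Omega := forall x y l, Omega x -> Omega y ->
  0 <= l <= 1 -> Omega (l *: x + (1 - l) *: y).

Definition plane Omega m e v s t := Omega (m + s *: e + t *: v).

(** The cap over the chord from m - a e to m + a e in direction v, cut from the
    disc with centre m - k v and radius sqrt (a^2 + k^2) > r. The radius is
    given through k to keep square roots away. *)
Definition capped Omega r := forall m e v a k s t,
  `|e| = 1 -> `|v| = 1 -> ip e v = 0 -> 0 < a -> 0 <= k ->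
  r ^+ 2 < a ^+ 2 + k ^+ 2 -> Omega (m - a *: e) -> Omega (m + a *: e) ->
  0 <= t -> s ^+ 2 + (t + k) ^+ 2 <= a ^+ 2 + k ^+ 2 ->
  Omega (m + s *: e + t *: v).

Lemma ipC u v : ip u v = ip v u.
Proof. by rewrite hermC expr0 mul1r. Qed.

Lemma ipDl u v w : ip (u + v) w = ip u w + ip v w.
Proof. exact: linearDl. Qed.

Lemma ipZl a u v : ip (a *: u) v = a * ip u v.
Proof. exact: linearZl_LR. Qed.

Lemma ipDr u v w : ip u (v + w) = ip u v + ip u w.
Proof. exact: linearDr. Qed.

Lemma ipZr a u v : ip u (a *: v) = a * ip u v.
Proof. by rewrite ipC ipZl ipC. Qed.

Lemma norm_comb a b u v :
  `|a *: u + b *: v| ^+ 2 = a ^+ 2 * `|u| ^+ 2 + 2 * a * b * ip u v + b ^+ 2 * `|v| ^+ 2.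
Proof.
rewrite -!ip_norm ipDl !ipDr !ipZl !ipZr (ipC v u).
by ring.
Qed.

Lemma norm_ortho a b u v : `|u| = 1 -> `|v| = 1 -> ip u v = 0 ->
  `|a *: u + b *: v| ^+ 2 = a ^+ 2 + b ^+ 2.
Proof. by move=> u1 v1 uv; rewrite norm_comb u1 v1 uv; ring. Qed.

Lemma closed_approx Omega x : closed Omega ->
  (forall d, 0 < d -> exists2 y, Omega y & `|x - y| < d) -> Omega x.
Proof.
move=> cO h; apply: cO => B /nbhs_ballP[d /= d0 dB].
have [y Oy xy] := h d d0; exists y; split=> //; apply: dB.
by rewrite -ball_normE.
Qed.

Lemma unit_ortho : dim_ge2 X -> forall u, exists2 v, `|v| = 1 & ip u v = 0.
Proof.
move=> [p [q pq]] u.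
suff [w w0 uw] : exists2 w, w != 0 & ip u w = 0.
  exists (`|w|^-1 *: w); first by rewrite normrZ normfV normr_id mulVf// normr_eq0.
  by rewrite ipZr uw mulr0.
have [up|up] := eqVneq (ip u p) 0.
  exists p => //; apply/eqP => p0; have := pq 1 0.
  by rewrite p0 scaler0 scale0r addr0 => /(_ erefl)[/eqP]; rewrite oner_eq0.
exists (ip u q *: p + (- ip u p) *: q).
  by apply/eqP => /pq[_ /eqP]; rewrite oppr_eq0 (negbTE up).
by rewrite ipDr !ipZr; ring.
Qed.

Lemma ortho_decomposition : dim_ge2 X -> forall e z, `|e| = 1 ->
  exists s t v, [/\ z = s *: e + t *: v, 0 <= t, `|v| = 1 & ip e v = 0].
Proof.
move=> dimX e z e1; pose w := z - ip e z *: e.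
have ew : ip e w = 0.
  rewrite /w -scaleNr ipDr ipZr ip_norm e1; ring.
have zE : z = ip e z *: e + w by rewrite /w addrC subrK.
have [w0|w0] := eqVneq w 0.
  have [v v1 ev] := unit_ortho dimX e.
  by exists (ip e z), 0, v; rewrite scale0r {1}zE w0.
exists (ip e z), `|w|, (`|w|^-1 *: w); split=> //.
- by rewrite scalerA divff ?normr_eq0// scale1r.
- by rewrite normrZ normfV normr_id mulVf// normr_eq0.
- by rewrite ipZr ew mulr0.
Qed.

Lemma plane_sub m e v s t s' t' :
  (m + s *: e + t *: v) - (m + s' *: e + t' *: v) = (s - s') *: e + (t - t') *: v.
Proof. by rewrite opprD addrACA opprD [X in X + _]addrACA subrr add0r -!scalerBl. Qed.

Lemma plane_convex Omega m e v : convex_subset Omega ->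
  planar_convex (plane Omega m e v).
Proof.
move=> cO s t s' t' l O1 O2 l01; rewrite /plane.
have := cO _ _ _ O1 O2 l01; congr Omega.
rewrite !scalerDr !scalerA addrACA [X in X + _]addrACA -!scalerDl.
by rewrite [l + _]addrC subrK scale1r.
Qed.

Lemma plane_closed Omega m e v : `|v| = 1 -> closed Omega ->
  vertically_closed (plane Omega m e v).
Proof.
move=> v1 cO s t h; apply: closed_approx => // d d0.
have [t' tt' Ot'] := h d d0; exists (m + s *: e + t' *: v) => //.
by rewrite plane_sub subrr scale0r add0r normrZ v1 mulr1.
Qed.

Lemma plane_mid m e v s t s' t' :
  2^-1 *: ((m + s *: e + t *: v) + (m + s' *: e + t' *: v)) =
  m + ((s + s') / 2) *: e + ((t + t') / 2) *: v.
Proof.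
rewrite addrACA [X in X + _]addrACA -!scalerDl !scalerDr !scalerA.
congr (_ + _ *: _ + _ *: _); [|exact: mulrC|exact: mulrC].
have h : 2^-1 + 2^-1 = 1 :> R by lra.
by rewrite -scalerDl h scale1r.
Qed.

Lemma constant_between r r' : 0 < r -> r < r' ->
  exists c, [/\ 0 < c, 8 * r * c < 1 & 1 < 8 * r' * c].
Proof.
move=> r0 rr'; exists ((1 / (8 * r) + 1 / (8 * r')) / 2); set c := (X in 0 < X).
have r'0 : 0 < r' by lra.
have cE : 16 * r * r' * c = r + r' by rewrite /c; field; lra.
have rr'0 : 0 < r * r' by exact: mulr_gt0.
have c0 : 0 < c by rewrite divr_gt0// addr_gt0// divr_gt0//; lra.
have c1 : 8 * r * c < 1 by rewrite -(@ltr_pM2l _ r')//; nra.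
have c2 : 1 < 8 * r' * c by rewrite -(@ltr_pM2l _ r)//; nra.
by split.
Qed.

Lemma capped_of_rises Omega r : 0 < r -> closed Omega -> convex_subset Omega ->
  (forall m e v a r', `|e| = 1 -> `|v| = 1 -> ip e v = 0 -> 0 < a -> r < r' ->
     Omega (m - a *: e) -> Omega (m + a *: e) ->
     cap_rises (plane Omega m e v) a r') -> capped Omega r.
Proof.
move=> r0 clO cO up m e v a k s t e1 v1 ev a0 k0 rak O1 O2 t0 h.
pose r' := Num.sqrt (a ^+ 2 + k ^+ 2).
have r'0 : 0 <= r' by exact: sqrtr_ge0.
have r'2 : r' ^+ 2 = a ^+ 2 + k ^+ 2 by rewrite sqr_sqrtr// addr_ge0 ?sqr_ge0.
have rr' : r < r'.
  by apply: (le_lt_trans (ler_norm _)); apply: norm_lt_sqr => //; rewrite r'2.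
apply: (sweep (O := plane Omega m e v) (a := a) (k := k) (r := r')) => //.
- exact: plane_convex.
- exact: plane_closed.
- exact: lt_trans r0 rr'.
- by rewrite /plane scale0r addr0 scaleNr.
- by rewrite /plane scale0r addr0.
- by apply: up.
- by split => //; rewrite r'2.
Qed.

Lemma capped_of_balls Omega r : 0 < r -> closed Omega -> convex_subset Omega ->
  (forall c, 0 < c -> 8 * r * c < 1 -> forall d, 0 < d ->
     exists2 b, 0 < b < d & forall x y, Omega x -> Omega y -> `|x - y| = b ->
       cball (2^-1 *: (x + y)) (c * b ^+ 2) `<=` Omega) ->
  capped Omega r.
Proof.
move=> r0 clO cO frq; apply: capped_of_rises => // m e v a r' e1 v1 ev a0 rr' O1 O2.
have [c [c0 c1 c2]] := constant_between r0 rr'.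
have r'0 : 0 < r' by lra.
apply: (cap_rises_of_balls (c := c)) => //.
- exact: plane_convex.
- by rewrite /plane scale0r addr0 scaleNr.
- by rewrite /plane scale0r addr0.
move=> d d0; have [b bd Hb] := frq c c0 c1 d d0.
exists b => // s t s' t' s'' t'' Oxy Oxy' eb hz.
have b0 : 0 < b by case/andP: bd.
apply: (Hb _ _ Oxy Oxy').
  rewrite plane_sub; apply/eqP; rewrite -(@eqrXn2 _ 2) ?normr_ge0 ?ltW//.
  by rewrite norm_ortho// eb.
rewrite /closed_ball_/= plane_mid plane_sub.
rewrite -(@ler_pXn2r _ 2) ?nnegrE ?normr_ge0//; last by rewrite mulr_ge0 ?sqr_ge0// ltW.
rewrite norm_ortho//; apply: le_trans hz.
by rewrite -[leLHS]addr0 -!(sqrrN (_ - s'')) -(sqrrN (_ - t'')) !opprB addr0.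
Qed.

Lemma capped_of_pointwise Omega r : 0 < r -> closed Omega -> convex_subset Omega ->
  (forall c, 0 < c -> 8 * r * c < 1 -> forall x, Omega x ->
     exists2 d, 0 < d & forall y v, Omega y -> 0 < `|x - y| < d -> `|v| = 1 ->
       ip v (x - y) = 0 -> Omega (2^-1 *: (x + y) + (c * `|x - y| ^+ 2) *: v)) ->
  capped Omega r.
Proof.
move=> r0 clO cO loc; apply: capped_of_rises => // m e v a r' e1 v1 ev a0 rr' O1 O2.
have [c [c0 c1 c2]] := constant_between r0 rr'.
have r'0 : 0 < r' by lra.
apply: (cap_rises_pointwise (c := c)) => //.
- exact: plane_convex.
- by rewrite /plane scale0r addr0 scaleNr.
- by rewrite /plane scale0r addr0.
move=> s t Ost; have [d d0 Hd] := loc c c0 c1 _ Ost; exists d => //.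
move=> x y f b Oxy /andP[f0 fd] xyf bf.
have ff : (c * f) ^+ 2 != 0 by rewrite expf_neq0// mulf_neq0 ?gt_eqF.
have b0 : b != 0 by apply: contra ff => /eqP b0; rewrite -bf b0 expr0n.
have xyE : (m + s *: e + t *: v) - (m + (s + x) *: e + (t + y) *: v) = (- x) *: e + (- y) *: v.
  by rewrite plane_sub; congr (_ *: _ + _ *: _); ring.
have nE : `|(m + s *: e + t *: v) - (m + (s + x) *: e + (t + y) *: v)| = f.
  rewrite xyE; apply/eqP; rewrite -(@eqrXn2 _ 2) ?normr_ge0 ?ltW//.
  by rewrite norm_ortho// !sqrrN xyf.
(* The unit vector p e + q v is orthogonal to the chord, and pushing the
   midpoint along it by c f^2 is adding b times the rotated chord. *)
pose p := - (b * y) / (c * f ^+ 2); pose q := b * x / (c * f ^+ 2).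
have cf0 : c * f ^+ 2 != 0 by rewrite mulf_neq0 ?expf_neq0 ?gt_eqF.
have w1 : `|p *: e + q *: v| = 1.
  apply/eqP; rewrite -(@eqrXn2 _ 2) ?normr_ge0// expr1n norm_ortho// /p /q.
  have -> : (- (b * y) / (c * f ^+ 2)) ^+ 2 + (b * x / (c * f ^+ 2)) ^+ 2 =
    b ^+ 2 * (x ^+ 2 + y ^+ 2) / (c * f ^+ 2) ^+ 2 by field; lra.
  by rewrite bf xyf; apply/eqP; field; lra.
have wo : ip (p *: e + q *: v) ((m + s *: e + t *: v) - (m + (s + x) *: e + (t + y) *: v)) = 0.
  rewrite xyE ipDl !ipDr !ipZl !ipZr (ipC v e) ev !ip_norm e1 v1.
  by rewrite /p /q; field; lra.
have := Hd _ _ Oxy; rewrite nE f0 fd => /(_ _ erefl w1 wo).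
rewrite plane_mid /plane; congr Omega.
rewrite scalerDr !scalerA addrACA -[X in X + _]addrA -!scalerDl; congr (_ + _ *: _ + _ *: _).
  by rewrite /p; field; lra.
by rewrite /q; field; lra.
Qed.
End Hilbert.

(** * Caps and r-convexity *)

Section Caps.
Context {R : realType} {X : normedModType R} (ip : {dot X for idfun}).
Hypothesis ip_norm : forall u : X, ip u u = `|u| ^+ 2.
Hypothesis dimX : dim_ge2 X.
Implicit Types (Omega : set X) (x y z m e u v w : X) (a b c d k r s t : R).

(** The ball around the midpoint of the chord whose radius is the height of the
    cap is covered by the caps over the chord in all directions. *)
Lemma capped_ball Omega r m e a k : capped ip Omega r -> `|e| = 1 -> 0 < a -> 0 <= k ->
  r ^+ 2 < a ^+ 2 + k ^+ 2 -> Omega (m - a *: e) -> Omega (m + a *: e) ->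
  cball m (Num.sqrt (a ^+ 2 + k ^+ 2) - k) `<=` Omega.
Proof.
move=> cap e1 a0 k0 rak O1 O2 z; rewrite /closed_ball_/= distrC => hz.
have [s [t [v [zE t0 v1 ev]]]] := ortho_decomposition ip_norm dimX (z - m) e1.
have -> : z = m + s *: e + t *: v by rewrite -addrA -zE addrC subrK.
have st : s ^+ 2 + t ^+ 2 = `|z - m| ^+ 2 by rewrite zE (norm_ortho ip_norm).
set r' := Num.sqrt _ in hz.
have r'2 : r' ^+ 2 = a ^+ 2 + k ^+ 2 by rewrite sqr_sqrtr// addr_ge0 ?sqr_ge0.
apply: (cap m e v a k s t) => //.
have st2 : s ^+ 2 + t ^+ 2 <= (r' - k) ^+ 2.
  by rewrite st lerXn2r ?nnegrE// (le_trans _ hz).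
have tr : t <= r' - k.
  apply/(le_trans (ler_norm _))/norm_le_sqr; first exact: le_trans hz.
  by have := sqr_ge0 s; lra.
rewrite -r'2; nra.
Qed.

(** Let q be the supremum of the radii of the balls around m contained in Omega.
    Over a chord of half-length a of the ball of radius q, the cap of radius
    r' < q rises by r' - sqrt (r'^2 - a^2), which is more than the amount
    q - sqrt (q^2 - a^2) that the midpoint of the chord lacks to the sphere. So
    the ball of radius q can be enlarged. *)
Lemma ball_growth Omega r m d : 0 < r -> capped ip Omega r -> closed Omega -> r < d ->
  cball m d `<=` Omega -> Omega = setT.
Proof.
move=> r0 cap clO rd Bd; apply: contrapT => OT.
have [z0 Oz0] : exists z, ~ Omega z.
  apply: contrapT => h; apply: OT; apply/seteqP; split=> // z _.
  by apply: contrapT => Oz; apply: h; exists z.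
pose S : set R := [set b | d <= b /\ cball m b `<=` Omega].
have Sd : S d by split.
have hS : has_sup S.
  split; first by exists d.
  exists `|m - z0| => b [db Bb]; rewrite leNgt; apply/negP => h.
  by apply: Oz0; apply: Bb; exact: ltW.
pose q := sup S.
have dq : d <= q by apply: ub_le_sup => //; exact: hS.2.
have Bq : cball m q `<=` Omega.
  move=> z; rewrite /closed_ball_/= => zq; apply: closed_approx => // f f0.
  have [zm|zm] := eqVneq z m.
    by exists m; [apply: Bd; rewrite /closed_ball_/= subrr normr0; lra|rewrite zm subrr normr0].
  have nz : 0 < `|m - z| by rewrite normr_gt0 subr_eq0 eq_sym.
  pose h := Num.min (1 / 2) (f / (2 * `|m - z|)).
  have h0 : 0 < h by rewrite lt_min !divr_gt0//; lra.
  have [h1 h2] : h <= 1 / 2 /\ h <= f / (2 * `|m - z|) by rewrite /h !ge_min !lexx orbT.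
  rewrite ler_pdivlMr in h2; last lra.
  exists (z + h *: (m - z)); last first.
    by rewrite opprD addrA subrr add0r normrN normrZ gtr0_norm//; lra.
  have [b [db Bb] bq] : exists2 b, S b & (1 - h) * q < b.
    have : 0 < h * q by rewrite mulr_gt0//; lra.
    move=> hq; have [b Sb hb] := sup_adherent hq hS; exists b => //.
    by rewrite -/q in hb; lra.
  apply: Bb; rewrite /closed_ball_/=.
  have -> : m - (z + h *: (m - z)) = (1 - h) *: (m - z).
    by rewrite opprD addrA scalerBl scale1r.
  rewrite normrZ ger0_norm; last lra.
  by have : (1 - h) * `|m - z| <= (1 - h) * q by [rewrite ler_wpM2l//; lra]; lra.
(* A 3-4-5 triangle makes the cap height r' / 5. *)
pose r' := (r + d) / 2; pose a := 3 / 5 * r'; pose k := 4 / 5 * r'.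
have r'r : r < r' by rewrite /r'; lra.
have r'q : r' < q by rewrite /r'; lra.
have ak : a ^+ 2 + k ^+ 2 = r' ^+ 2 by rewrite /a /k; field.
have qa : 0 <= q ^+ 2 - a ^+ 2 by rewrite /a; nra.
pose w := Num.sqrt (q ^+ 2 - a ^+ 2).
have w2 : w ^+ 2 = q ^+ 2 - a ^+ 2 by rewrite sqr_sqrtr.
have w0 : 0 <= w by exact: sqrtr_ge0.
have wq : q < w + r' / 5.
  suff : q - r' / 5 < w by lra.
  rewrite -(@ltr_pXn2r _ 2) ?nnegrE//; last by lra.
  by rewrite w2 /a; nra.
suff : S (w + r' / 5) by move/(ub_le_sup hS.2); rewrite -/q; lra.
split; first lra.
move=> z; rewrite /closed_ball_/= distrC => zw.
have [e [e1 zE]] : exists e, `|e| = 1 /\ z - m = `|z - m| *: e.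
  have [zm|zm] := eqVneq (z - m) 0.
    have [v v1 _] := unit_ortho ip dimX 0.
    by exists v; rewrite zm normr0 scale0r.
  exists (`|z - m|^-1 *: (z - m)); split.
    by rewrite normrZ normfV normr_id mulVf// normr_eq0.
  by rewrite scalerA divff ?normr_eq0// scale1r.
have [v v1 ev] := unit_ortho ip dimX e.
set n := `|z - m| in zw zE.
pose l := Num.max 0 (n - r' / 5).
have n0 : 0 <= n := normr_ge0 _.
have [l0 lw lu] : [/\ 0 <= l, l <= w & `|n - l| <= r' / 5].
  clear -n0 zw w0 r'r r0; clearbody r' w n.
  rewrite /l; have [h|h] := leP 0 (n - r' / 5); split; try lra.
    by rewrite opprB addrC subrK ger0_norm//; lra.
  by rewrite subr0 ger0_norm//; lra.
have hu b : b ^+ 2 = a ^+ 2 -> Omega (m + l *: e + b *: v).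
  move=> b2; apply: Bq; rewrite /closed_ball_/= -addrA opprD addrA subrr add0r normrN.
  apply: (le_trans (ler_norm _)); apply: norm_le_sqr; first lra.
  rewrite (norm_ortho ip_norm)// b2.
  have : l ^+ 2 <= w ^+ 2 by rewrite lerXn2r ?nnegrE.
  by rewrite w2; lra.
have kr : Num.sqrt (a ^+ 2 + k ^+ 2) - k = r' / 5.
  rewrite ak sqrtr_sqr gtr0_norm /k; lra.
apply: (@capped_ball Omega r (m + l *: e) v a k) => //.
- by rewrite /a; lra.
- by rewrite /k; lra.
- by rewrite ak; nra.
- by rewrite -scaleNr; apply: hu; rewrite sqrrN.
- exact: hu.
rewrite kr /closed_ball_/= distrC.
have -> : z - (m + l *: e) = (n - l) *: e by rewrite opprD addrA zE -scalerBl.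
by rewrite normrZ e1 mulr1.
Qed.

(** In the plane of x, y and z, the disc of radius r through x and y with centre
    on the far side from z is one of the balls in the intersection, so z is in
    the cap of radius r, and points close to z on the segment to the midpoint m
    are in caps of larger radius. *)
Lemma r_convex_of_capped Omega r : 0 < r -> closed Omega -> capped ip Omega r ->
  r_convex r Omega.
Proof.
move=> r0 clO cap x y Ox Oy z zc.
have [xy|xy] := eqVneq x y.
  have [->//|zx] := eqVneq z x.
  have nzx : 0 < `|x - z| by rewrite normr_gt0 subr_eq0 eq_sym.
  (* The ball of radius r touching x from the side opposite to z misses z. *)
  exfalso; pose c := x + (r / `|x - z|) *: (x - z).
  have cx : `|c - x| = r.
    by rewrite /c addrAC subrr add0r normrZ gtr0_norm ?divr_gt0// divfK ?gt_eqF.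
  have /zc : [set c | cball c r x /\ cball c r y] c by rewrite -xy /closed_ball_/= cx.
  rewrite /closed_ball_/= /c addrAC -{1}[x - z]scale1r -scalerDl normrZ gtr0_norm; last first.
    by rewrite addr_gt0// divr_gt0.
  by rewrite mulrDl mul1r divfK ?gt_eqF//; lra.
have nxy : 0 < `|x - y| by rewrite normr_gt0 subr_eq0.
pose a := `|x - y| / 2; pose e := `|x - y|^-1 *: (x - y); pose m := 2^-1 *: (x + y).
have e1 : `|e| = 1 by rewrite normrZ normfV normr_id mulVf// gt_eqF.
have a0 : 0 < a by rewrite divr_gt0.
have ae : a *: e = 2^-1 *: (x - y).
  by rewrite scalerA mulrAC divff ?gt_eqF// mul1r.
have h2 : 2^-1 + 2^-1 = 1 :> R by lra.
have xE : m + a *: e = x.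
  by rewrite ae -scalerDr addrACA subrr addr0 scalerDr -scalerDl h2 scale1r.
have yE : m - a *: e = y.
  by rewrite ae -scalerBr opprB addrC addrA subrK scalerDr -scalerDl h2 scale1r.
(* For k = 0 the caps are half discs: a long chord gives a ball of radius > r. *)
have [ra|ar] := ltP r a.
  suff -> : Omega = setT by [].
  have cO : cball m a `<=` Omega.
    have := @capped_ball Omega r m e a 0 cap e1 a0 (lexx _).
    rewrite expr0n/= addr0 sqrtr_sqr gtr0_norm// subr0 xE yE; apply=> //.
    nra.
  exact: (ball_growth r0 cap clO ra cO).
have rk : 0 <= r ^+ 2 - a ^+ 2 by nra.
pose k := Num.sqrt (r ^+ 2 - a ^+ 2).
have k2 : k ^+ 2 = r ^+ 2 - a ^+ 2 by rewrite sqr_sqrtr.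
have k0 : 0 <= k by exact: sqrtr_ge0.
have [s [t [v [zE t0 v1 ev]]]] := ortho_decomposition ip_norm dimX (z - m) e1.
have {}zE : z = m + s *: e + t *: v by rewrite -addrA -zE addrC subrK.
pose c := m + 0 *: e + (- k) *: v.
have h b : b ^+ 2 = a ^+ 2 -> cball c r (m + b *: e).
  move=> b2; rewrite /closed_ball_/= distrC.
  have -> : m + b *: e = m + b *: e + 0 *: v by rewrite scale0r addr0.
  rewrite plane_sub; apply/(le_trans (ler_norm _))/norm_le_sqr; first lra.
  by rewrite (norm_ortho ip_norm)// subr0 b2 opprK add0r k2; lra.
have /zc : [set c | cball c r x /\ cball c r y] c.
  split; [rewrite -xE; exact: h|rewrite -yE -scaleNr; apply: h; exact: sqrrN].
rewrite /closed_ball_/= distrC zE plane_sub => hz.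
have {}hz : s ^+ 2 + (t + k) ^+ 2 <= r ^+ 2.
  have : `|(s - 0) *: e + (t - - k) *: v| ^+ 2 <= r ^+ 2 by rewrite lerXn2r ?nnegrE// ltW.
  by rewrite (norm_ortho ip_norm)// subr0 opprK.
apply: closed_approx => // d d0.
(* The point is scaled towards m by h' < 1, and k is increased by a g > 0 for
   which the scaled point is still in the cap. *)
pose n := `|s *: e + t *: v|.
have n0 : 0 <= n := normr_ge0 _.
pose f := d / (n + 1).
have f0 : 0 < f by rewrite divr_gt0//; lra.
have fE : f * (n + 1) = d by rewrite /f divfK//; lra.
pose h' := (1 + f)^-1.
have h'E : h' * (1 + f) = 1 by rewrite mulVf//; lra.
have h'0 : 0 < h' by rewrite invr_gt0; lra.
have h'1 : h' < 1 by nra.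
pose g := a ^+ 2 * f / (2 * (t + 1)).
have a2f : 0 < a ^+ 2 * f by rewrite mulr_gt0 ?exprn_gt0.
have g0 : 0 < g by rewrite divr_gt0//; lra.
have gE : g * (2 * (t + 1)) = a ^+ 2 * f by rewrite /g divfK//; lra.
exists (m + (h' * s) *: e + (h' * t) *: v).
  apply: (cap m e v a (k + g)) => //.
  - by lra.
  - by nra.
  - by rewrite yE.
  - by rewrite xE.
  - by rewrite mulr_ge0// ltW.
  have s2 := sqr_ge0 s; have t2 := sqr_ge0 t.
  suff : h' * (h' * (s ^+ 2 + t ^+ 2) + 2 * t * (k + g)) <= a ^+ 2 by lra.
  have -> : a ^+ 2 = h' * (a ^+ 2 * (1 + f)) by rewrite mulrCA h'E mulr1.
  rewrite ler_pM2l//.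
  have : h' * (s ^+ 2 + t ^+ 2) <= s ^+ 2 + t ^+ 2 by rewrite ler_piMl//; lra.
  nra.
rewrite plane_sub.
have -> : (s - h' * s) *: e + (t - h' * t) *: v = (1 - h') *: (s *: e + t *: v).
  by rewrite scalerDr !scalerA !mulrBl !mul1r.
rewrite normrZ gtr0_norm -/n; last lra.
have -> : 1 - h' = h' * f by rewrite -{1}h'E; ring.
nra.
Qed.

(** By the parallelogram identity, a centre c of a ball of radius r containing x
    and y satisfies |c - m|^2 <= r^2 - |x - y|^2 / 4 for the midpoint m, and
    this is at most (r - |x - y|^2 / (8r))^2. *)
Lemma ball_of_r_convex Omega r x y : 0 < r -> r_convex r Omega -> Omega x -> Omega y ->
  `|x - y| <= 2 * r ->
  cball (2^-1 *: (x + y)) (`|x - y| ^+ 2 / (8 * r)) `<=` Omega.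
Proof.
move=> r0 rO Ox Oy xyr z; rewrite /closed_ball_/= => hz.
apply: (rO x y) => // c []; rewrite /closed_ball_/= => cx cy.
pose m := 2^-1 *: (x + y).
have par : `|c - m| ^+ 2 = (`|c - x| ^+ 2 + `|c - y| ^+ 2) / 2 - `|x - y| ^+ 2 / 4.
  have -> : c - m = 2^-1 *: (c - x) + 2^-1 *: (c - y).
    rewrite /m -scalerDr addrACA -opprD scalerBr; congr (_ - _).
    have h2 : 2^-1 + 2^-1 = 1 :> R by lra.
    by rewrite scalerDr -scalerDl h2 scale1r.
  have -> : x - y = 1 *: (c - y) + (-1) *: (c - x).
    by rewrite scale1r scaleN1r opprB [RHS]addrC addrA subrK.
  by rewrite !(norm_comb ip_norm) (ipC ip (c - y)); field.
have cx2 : `|c - x| ^+ 2 <= r ^+ 2 by rewrite lerXn2r ?nnegrE// ltW.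
have cy2 : `|c - y| ^+ 2 <= r ^+ 2 by rewrite lerXn2r ?nnegrE// ltW.
set f := `|x - y| in xyr par hz.
have f0 : 0 <= f := normr_ge0 _.
have fr : f ^+ 2 / (8 * r) <= r / 2.
  by rewrite ler_pdivrMr; [nra|lra].
have cm : `|c - m| <= r - f ^+ 2 / (8 * r).
  apply/(le_trans (ler_norm _))/norm_le_sqr; first lra.
  rewrite par.
  have -> : (r - f ^+ 2 / (8 * r)) ^+ 2 = r ^+ 2 - f ^+ 2 / 4 + (f ^+ 2 / (8 * r)) ^+ 2.
    by field; lra.
  by have := sqr_ge0 (f ^+ 2 / (8 * r)); lra.
have -> : c - z = (c - m) + (m - z) by rewrite addrA subrK.
by apply: (le_trans (ler_normD _ _)); lra.
Qed.

Lemma convex_of_r_convex Omega r : r_convex r Omega -> convex_subset Omega.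
Proof.
move=> rO x y l Ox Oy /andP[l0 l1]; apply: (rO x y) => // c []; rewrite /closed_ball_/= => cx cy.
have -> : c - (l *: x + (1 - l) *: y) = l *: (c - x) + (1 - l) *: (c - y).
  rewrite !scalerBr addrACA -opprD; congr (_ - _).
  by rewrite -scalerDl addrC subrK scale1r.
apply: (le_trans (ler_normD _ _)); rewrite !normrZ !ger0_norm; [|lra|lra].
nra.
Qed.

End Caps.

(** * Closed connected sets containing the midpoints of short chords *)

Section Local_convexity.
Context {R : realType} {X : normedModType R}.
Implicit Types (Omega : set X) (x y z : X) (a : nat -> X) (d f l q M : R).

Definition chain Omega d (n : nat) a := (forall i, (i <= n)%N -> Omega (a i)) /\
  (forall i, (i < n)%N -> `|a i - a i.+1| <= d).

Definition chained Omega d x y := exists n a, [/\ chain Omega d n a, a 0%N = x & a n = y].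

(** The points reachable by chains of step d form a relatively open and closed
    subset. *)
Lemma chained_connected Omega d x y : 0 < d -> connected Omega ->
  Omega x -> Omega y -> chained Omega d x y.
Proof.
move=> d0 cO Ox Oy; pose B : set X := [set z | chained Omega d x z].
have Bx : B x by exists 0%N, (fun=> x); split => //; split.
have BO : B `<=` Omega by move=> z [n [a [[Oa _] _ <-]]]; exact: Oa.
have ext z w : B z -> Omega w -> `|z - w| <= d -> B w.
  move=> [n [a [[Oa da] a0 an]]] Ow zw.
  exists n.+1, (fun i => if (i <= n)%N then a i else w); split => //; last by rewrite ltnn.
  split=> i; first by move=> _; case: ifPn => // /Oa.
  rewrite ltnS => lin; rewrite lin; case: ifPn => [/da//|nin].
  have -> : i = n by apply/eqP; rewrite eqn_leq lin leqNgt.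
  by rewrite an.
suff BE : B = Omega by have : B y by [rewrite BE].
apply: cO; first by exists x.
  exists (\bigcup_(z in B) ball z d).
    by apply: bigcup_open => z _; exact: ball_open.
  apply/seteqP; split=> [z Bz|z [Oz [w Bw]]].
    by split; [exact: BO|exists z => //; exact: ballxx].
  by rewrite -ball_normE => /ltW; exact: ext.
exists (closure B); first exact: closed_closure.
apply/seteqP; split=> [z Bz|z [Oz]].
  by split; [exact: BO|exact: subset_closure].
move=> /(_ _ (nbhsx_ballx z _ d0))[w [Bw]]; rewrite -ball_normE /= distrC => /ltW.
exact: ext.
Qed.

Definition chord_point n x y i := x + (i%:R / n%:R) *: (y - x) : X.

(** Vanishes at the ends and exceeds the mean of its two neighbouring values by
    exactly 1: the weight that makes averaging a contraction. *)
Definition parabola n (i : nat) : R := i%:R * (n%:R - i%:R).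

Definition averaged n a i :=
  if (0 < i < n)%N then 2^-1 *: (a i.-1 + a i.+1) else a i.

Definition near_chord Omega d n x y M a := [/\ chain Omega d n a, a 0%N = x, a n = y &
  forall i, (i <= n)%N -> `|a i - chord_point n x y i| <= M * parabola n i].

(** Averaging keeps the vertices in Omega, as the neighbours of a vertex are at
    distance at most 2 d, and does not lengthen the longest step. Being linear
    and fixing the straight chain, it also averages the deviations from that
    chain, and the weighted deviation shrinks by the factor 1 - 1 / n^2, because
    the weight is at most n^2. *)
Lemma averaged_near_chord Omega d n x y M a : 0 <= M ->
  (forall z w, Omega z -> Omega w -> `|z - w| <= 2 * d -> Omega (2^-1 *: (z + w))) ->
  near_chord Omega d n x y M a ->
  near_chord Omega d n x y ((1 - (n%:R ^+ 2)^-1) * M) (averaged n a).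
Proof.
move=> M0 mid [[Oa da] a0 an ha].
have half u : `|2^-1 *: u| = `|u| / 2 :> R.
  by rewrite normrZ gtr0_norm ?invr_gt0// mulrC.
have h2 : 2^-1 + 2^-1 = 1 :> R by lra.
have two i : (i.+1 < n)%N -> `|a i - a i.+2| <= 2 * d.
  move=> lin; have -> : a i - a i.+2 = (a i - a i.+1) + (a i.+1 - a i.+2) by rewrite addrA subrK.
  by apply: (le_trans (ler_normD _ _)); have := da i (ltnW lin); have := da _ lin; lra.
have n0 : averaged n a 0 = a 0%N by [].
have nn : averaged n a n = a n by rewrite /averaged ltnn andbF.
split; [split| | |]; rewrite ?n0 ?nn//.
- move=> i lin; rewrite /averaged; case: ifPn => [/andP[i0 iltn]|_]; last exact: Oa.
  case: i i0 lin iltn => // i _ _ iltn /=; apply: mid; [apply: Oa|exact: Oa|exact: two].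
  exact: ltnW (ltnW iltn).
- move=> i lin; rewrite /averaged /= lin.
  case: i lin => [|i] lin /=.
    case: ifPn => [n1|_]; last exact: da.
    have -> : a 0%N - 2^-1 *: (a 0%N + a 2%N) = 2^-1 *: (a 0%N - a 2%N).
      rewrite scalerDr scalerBr opprD addrA; congr (_ - _).
      by rewrite -{1}[a 0%N]scale1r -scalerBl; congr (_ *: _); lra.
    by rewrite half; have := two 0%N n1; lra.
  case: ifPn => [n1|n1].
    rewrite -scalerBr half.
    have -> : a i + a i.+2 - (a i.+1 + a i.+3) = (a i - a i.+1) + (a i.+2 - a i.+3).
      by rewrite opprD addrACA.
    have := ler_normD (a i - a i.+1) (a i.+2 - a i.+3).
    by have := da i (ltnW lin); have := da _ n1; lra.
  have -> : 2^-1 *: (a i + a i.+2) - a i.+2 = 2^-1 *: (a i - a i.+2).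
    rewrite scalerDr scalerBr -addrA; congr (_ + _).
    by rewrite -{2}[a i.+2]scale1r -scalerBl -scaleNr; congr (_ *: _); lra.
  by rewrite half; have := two i lin; lra.
move=> i lin; rewrite /averaged; case: ifPn => [/andP[i0 iltn]|hi].
  case: i i0 lin iltn => // i _ lin iltn.
  have n1 : 1 <= n%:R :> R by rewrite ler1n; exact: leq_trans lin.
  have e1 : i.+1%:R = i%:R + 1 :> R by rewrite natr1.
  have e2 : i.+2%:R = i%:R + 2 :> R by rewrite -natrD addn2.
  have -> : 2^-1 *: (a i + a i.+2) - chord_point n x y i.+1 =
    2^-1 *: ((a i - chord_point n x y i) + (a i.+2 - chord_point n x y i.+2)).
    rewrite addrACA [RHS]scalerDr; congr (_ + _).
    rewrite /chord_point; move: (y - x) => D.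
    rewrite -opprD scalerN addrACA -scalerDl.
    rewrite scalerDr scalerA.
    have -> : 2^-1 *: (x + x) = x by rewrite scalerDr -scalerDl h2 scale1r.
    congr (- (_ + _ *: _)); rewrite e1 e2; field; lra.
  rewrite half ler_pdivrMr//; apply: (le_trans (ler_normD _ _)).
  have := ha i (ltnW lin); have := ha _ iltn => h1 h3.
  apply: le_trans (lerD h3 h1) _.
  have -> : (1 - (n%:R ^+ 2)^-1) * M * parabola n i.+1 * 2 =
    M * ((1 - (n%:R ^+ 2)^-1) * parabola n i.+1 * 2) by ring.
  rewrite -mulrDr ler_wpM2l//.
  rewrite /parabola e1 e2.
  have i0 : 0 <= i%:R :> R by [].
  have iN : i%:R + 2 <= n%:R :> R by rewrite -natrD ler_nat addn2.
  set I := i%:R in i0 iN *; set N := n%:R in iN n1 *.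
  have : (N ^+ 2)^-1 * ((I + 1) * (N - (I + 1))) <= 1.
    by rewrite mulrC ler_pdivrMr ?exprn_gt0//; [nra|lra].
  lra.
have -> : a i = chord_point n x y i.
  have [i0|i0] := posnP i; first by rewrite i0 a0 /chord_point mul0r scale0r addr0.
  have iE : i = n by apply/eqP; rewrite eqn_leq lin leqNgt; rewrite i0 in hi.
  rewrite iE an /chord_point divff ?scale1r ?subrKC// pnatr_eq0 -lt0n -iE//.
rewrite subrr normr0 mulr_ge0//; last by rewrite mulr_ge0// subr_ge0 ler_nat.
rewrite mulr_ge0// subr_ge0.
have [->|n00] := posnP n; first by rewrite expr0n/= invr0.
by rewrite invf_le1 ?exprn_gt0 ?ltr0n// expr_ge1// ?ler1n// ltW.
Qed.

(** The averaged chains converge to the straight one, whose points are therefore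
    in the closed set Omega. *)
Lemma chord_point_in Omega d n x y a : closed Omega ->
  (forall z w, Omega z -> Omega w -> `|z - w| <= 2 * d -> Omega (2^-1 *: (z + w))) ->
  chain Omega d n a -> a 0%N = x -> a n = y ->
  forall i, (i <= n)%N -> Omega (chord_point n x y i).
Proof.
move=> clO mid ca a0 an i lin.
pose M : R := \sum_(j < n) `|a j - chord_point n x y j|.
have M0 : 0 <= M by apply: sumr_ge0.
have near0 : near_chord Omega d n x y M a.
  split => // j ljn.
  have [j0|j0] := posnP j.
    by rewrite j0 a0 /chord_point mul0r scale0r addr0 subrr normr0 /parabola mul0r mulr0.
  have [jn|jn] := eqVneq j n.
    rewrite jn an /chord_point divff ?scale1r ?subrKC ?subrr ?normr0; last first.
      by rewrite pnatr_eq0 -lt0n -jn.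
    by rewrite /parabola subrr !mulr0.
  have jltn : (j < n)%N by rewrite ltn_neqAle jn.
  apply: le_trans (_ : M * 1 <= _).
    rewrite mulr1 /M (bigD1 (Ordinal jltn))//= lerDl; exact: sumr_ge0.
  apply: ler_wpM2l => //; rewrite /parabola.
  have : 1 <= j%:R :> R by rewrite ler1n.
  have : j%:R + 1 <= n%:R :> R by rewrite natr1 ler_nat.
  nra.
pose q : R := 1 - (n%:R ^+ 2)^-1.
have q0 : 0 <= q.
  rewrite subr_ge0; have [->|n00] := posnP n; first by rewrite expr0n/= invr0.
  by rewrite invf_le1 ?exprn_gt0 ?ltr0n// expr_ge1// ?ler1n// ltW.
have iter_near k : near_chord Omega d n x y (q ^+ k * M) (iter k (averaged n) a).
  elim: k => [|k IH]; first by rewrite mul1r.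
  by rewrite exprS -mulrA; apply: averaged_near_chord => //; rewrite mulr_ge0 ?exprn_ge0.
have [n00|n00] := posnP n.
  by move: lin; rewrite n00 leqn0 => /eqP ->; rewrite /chord_point mul0r scale0r addr0 -a0; apply ca.
have q1 : `|q| < 1.
  by rewrite ger0_norm// /q gtrDl oppr_lt0 invr_gt0 exprn_gt0// ltr0n.
have cvq : q ^+ k * (M * parabola n i) @[k --> \oo] --> (0 : R).
  rewrite -[0](mul0r (M * parabola n i)); apply: cvgM; last exact: cvg_cst.
  exact: cvg_expr.
apply: closed_approx => // f f0.
have [k _ hk] := cvgr_lt _ cvq _ f0.
have [[Oa _] _ _ ha] := iter_near k.
exists (iter k (averaged n) a i); first exact: Oa.
by rewrite distrC; apply: le_lt_trans (ha i lin) _; rewrite -mulrA; apply: hk => /=.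
Qed.

(** Chains of arbitrarily small step give points of Omega arbitrarily dense on the
    segment. *)
Lemma convex_of_local_midpoints Omega f : 0 < f -> closed Omega -> connected Omega ->
  (forall x y, Omega x -> Omega y -> `|x - y| < f -> Omega (2^-1 *: (x + y))) ->
  convex_subset Omega.
Proof.
move=> f0 clO coO mid x y l Ox Oy /andP[l0 l1]; apply: closed_approx => // g g0.
pose d := Num.min (f / 3) (g / 2).
have d0 : 0 < d by rewrite lt_min !divr_gt0.
have [d1 d2] : d <= f / 3 /\ d <= g / 2 by rewrite /d !ge_min !lexx orbT.
have [n [a [ca a0 an]]] := chained_connected d0 coO Ox Oy.
have cp := chord_point_in clO _ ca a0 an.
have {}cp i : (i <= n)%N -> Omega (chord_point n x y i).
  by apply: cp => z w Oz Ow zw; apply: mid => //; lra.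
have xyn i : (i <= n)%N -> `|a 0%N - a i| <= i%:R * d.
  elim: i => [|i IH] lin; first by rewrite subrr normr0 mul0r.
  have -> : a 0%N - a i.+1 = (a 0%N - a i) + (a i - a i.+1) by rewrite addrA subrK.
  apply: (le_trans (ler_normD _ _)); rewrite -natr1 mulrDl mul1r.
  by apply: lerD; [exact: IH (ltnW lin)|apply ca].
have {xyn} := xyn n (leqnn _); rewrite a0 an => xyn.
have [n0|n0] := posnP n.
  exists x => //; move: an; rewrite n0 a0 => <-.
  by rewrite -scalerDl [l + _]addrC subrK scale1r subrr normr0.
have nR : 0 < n%:R :> R by rewrite ltr0n.
pose i := Num.truncn ((1 - l) * n%:R).
have ln0 : 0 <= (1 - l) * n%:R by rewrite mulr_ge0//; lra.
have /andP[i1 i2] := truncn_itv ln0; rewrite -/i in i1 i2.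
have lin : (i <= n)%N.
  by rewrite -(ler_nat R); apply: (le_trans i1); rewrite ler_piMl// ; lra.
exists (chord_point n x y i); first exact: cp.
have -> : l *: x + (1 - l) *: y - chord_point n x y i = ((1 - l) - i%:R / n%:R) *: (y - x).
  rewrite /chord_point opprD addrA [RHS]scalerBl; congr (_ - _).
  by rewrite addrAC scalerBr addrC; congr (_ + _); rewrite scalerBl scale1r opprB.
rewrite normrZ ger0_norm; last by rewrite subr_ge0 ler_pdivrMr.
have h : (1 - l - i%:R / n%:R) * n%:R <= 1.
  by rewrite mulrBl divfK ?gt_eqF//; rewrite -natr1 in i2; lra.
have h0 : 0 <= 1 - l - i%:R / n%:R by rewrite subr_ge0 ler_pdivrMr.
rewrite distrC; nra.
Qed.

End Local_convexity.

(** * Moduli and limits *)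

Section Moduli.
Context {R : realType}.
Implicit Types (b c d l : R).

(** The limit is the supremum of the eventual lower bounds; the second hypothesis
    turns every larger number into an eventual upper bound. *)
Lemma cvg_of_dichotomy (T : Type) (F : set_system T) (f : T -> \bar R) c : Filter F ->
  (\forall x \near F, (c%:E <= f x)%E) ->
  (forall b, c < b -> (\forall x \near F, (b%:E <= f x)%E) \/
                      (\forall x \near F, (f x <= b%:E)%E)) ->
  exists l : \bar R, f x @[x --> F] --> l /\ (c%:E <= l)%E.
Proof.
move=> FF cf dich; pose S : set R := [set b | c <= b /\ \forall x \near F, (b%:E <= f x)%E].
have Sc : S c by split.
have [hS|nS] := pselect (has_ubound S); last first.
  exists +oo%E; split; last by rewrite leey.
  apply/cvgeyPge => A; apply: contrapT => nA; apply: nS; exists A => b [_ bf].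
  rewrite leNgt; apply/negP => Ab; apply: nA; apply: filterS bf => x.
  by apply: le_trans; rewrite lee_fin ltW.
have hs : has_sup S by split => //; exists c.
have cs : c <= sup S by apply: ub_le_sup.
exists (sup S)%:E; split; last by rewrite lee_fin.
move=> A /= [e /= e0 eA].
have [b [cb bf] bs] := sup_adherent e0 hs.
have ubf : \forall x \near F, (f x <= (sup S + e / 2)%:E)%E.
  have [h|//] := dich (sup S + e / 2) ltac:(lra).
  have : S (sup S + e / 2) by split => //; lra.
  by move=> /(ub_le_sup hS); lra.
apply: filterS2 bf ubf => x; rewrite /preimage/=.
case: (f x) => [y||]; rewrite ?lee_fin ?leeNy_eq ?leye_eq// => h1 h2.
apply: (eA y) => /=; rewrite ltr_norml; apply/andP; split; lra.
Qed.

Lemma near_right0P (P : R -> Prop) :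
  (\forall e \near 0^'+, P e) <-> exists2 d, 0 < d & forall e, 0 < e < d -> P e.
Proof.
split=> [[d /= d0 dP]|[d d0 dP]].
  exists d => // e /andP[e0 ed]; apply: dP => //=.
  by rewrite sub0r normrN gtr0_norm.
near=> e; apply: dP; apply/andP; split.
  by near: e; exact: nbhs_right_gt.
by near: e; exact: nbhs_right_lt.
Unshelve. all: by end_near.
Qed.

Lemma ratio_gt (x : \bar R) b e : 0 < e ->
  (b%:E < x / (e ^+ 2)%:E)%E = ((b * e ^+ 2)%:E < x)%E.
Proof. by move=> e0; rewrite inver gt_eqF ?exprn_gt0// lte_pdivlMr ?exprn_gt0. Qed.

Lemma ratio_ge (x : \bar R) b e : 0 < e ->
  (b%:E <= x / (e ^+ 2)%:E)%E = ((b * e ^+ 2)%:E <= x)%E.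
Proof. by move=> e0; rewrite inver gt_eqF ?exprn_gt0// lee_pdivlMr ?exprn_gt0. Qed.

Context {X : normedModType R} (ip : {dot X for idfun}).
Implicit Types (Omega : set X) (x y v : X).

Lemma delta_modulus_gt Omega e c : (c%:E < delta_modulus Omega e)%E ->
  forall x y, Omega x -> Omega y -> `|x - y| = e -> cball (2^-1 *: (x + y)) c `<=` Omega.
Proof.
move=> /ereal_sup_gt[_ [d [d0 Hd] <-]]; rewrite lte_fin => cd x y Ox Oy xy z hz.
by apply: Hd Oy xy _ _ => //; apply: le_trans hz (ltW cd).
Qed.

Lemma le_delta_modulus Omega e c : 0 <= c ->
  (forall x y, Omega x -> Omega y -> `|x - y| = e -> cball (2^-1 *: (x + y)) c `<=` Omega) ->
  (c%:E <= delta_modulus Omega e)%E.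
Proof. by move=> c0 Hc; apply: ereal_sup_ubound; exists c. Qed.

Lemma midpoint_in Omega x y : convex_subset Omega -> Omega x -> Omega y ->
  Omega (2^-1 *: (x + y)).
Proof.
move=> cO Ox Oy; have := cO x y 2^-1 Ox Oy ltac:(lra).
by have -> : 1 - 2^-1 = 2^-1 :> R by [lra]; rewrite scalerDr.
Qed.

(** A number below the supremum belongs to the set because, Omega being convex,
    that set is an interval containing 0. *)
Lemma delta_circ_gt Omega x e c : convex_subset Omega -> Omega x -> 0 < c ->
  (c%:E < delta_circ ip Omega x e)%E ->
  forall y v, Omega y -> `|v| = 1 -> `|x - y| = e -> ip v (x - y) = 0 ->
    Omega (2^-1 *: (x + y) + c *: v).
Proof.
move=> cO Ox c0 /ereal_sup_gt[_ [d [d0 Hd] <-]]; rewrite lte_fin => cd y v Oy v1 xy vxy.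
have := midpoint_in cO Ox Oy; have := Hd y v Oy v1 xy vxy.
move: (2^-1 *: (x + y)) => m Omd Om.
have := cO _ _ (c / d) Omd Om.
rewrite scalerDr addrAC -scalerDl [c / d + _]addrC subrK scale1r scalerA divfK; last by lra.
apply.
by rewrite divr_ge0 ?ler_pdivrMr; lra.
Qed.

Lemma le_delta_circ Omega x e : Omega x ->
  (delta_modulus Omega e <= delta_circ ip Omega x e)%E.
Proof.
move=> Ox; apply: le_ereal_sup => _ [d [d0 Hd] <-]; exists d => //; split=> // y v Oy v1 xy _.
apply: (Hd x y) => //; rewrite /closed_ball_/= opprD addrA subrr add0r normrN normrZ v1 mulr1.
by rewrite ger0_norm.
Qed.

Lemma convex_setE Omega : convex_set (Omega : set (convex_lmodType X)) <-> convex_subset Omega.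
Proof.
split=> [cO x y l Ox Oy /andP[l0 l1]|cO x y l].
  have := cO x y (Itv01 l0 l1); rewrite !inE => h.
  exact: h.
rewrite !inE => Ox Oy; apply: cO => //; apply/andP; split; [exact: ge0|exact: le1].
Qed.
End Moduli.

(** * The equivalences *)

Section Equivalences.
Context {R : realType} {X : normedModType R} (ip : {dot X for idfun}).
Hypothesis ip_norm : forall u : X, ip u u = `|u| ^+ 2.
Hypothesis dimX : dim_ge2 X.
Implicit Types (Omega : set X) (x y v : X) (b c d e r : R).

Lemma delta_modulus_of_r_convex Omega r e : 0 < r -> r_convex r Omega -> 0 < e < 2 * r ->
  ((1 / (8 * r))%:E <= delta_modulus Omega e / (e ^+ 2)%:E)%E.
Proof.
move=> r0 rO /andP[e0 er]; rewrite ratio_ge//; apply: le_delta_modulus.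
  by rewrite mulr_ge0 ?sqr_ge0// divr_ge0//; lra.
move=> x y Ox Oy xy; have := ball_of_r_convex ip_norm r0 rO Ox Oy.
by rewrite xy mul1r [_^-1 * _]mulrC; apply; lra.
Qed.

(** The estimate is assumed for arbitrarily small e only, whereas r-convexity
    gives it back for all small e. This is what makes the limit of the quotient
    exist. *)
Lemma r_convex_of_frequent_balls Omega c : 0 < c -> closed Omega -> convex_subset Omega ->
  (forall d, 0 < d -> exists2 e, 0 < e < d &
     (c%:E < delta_modulus Omega e / (e ^+ 2)%:E)%E) ->
  r_convex (1 / (8 * c)) Omega.
Proof.
move=> c0 clO cO frq.
have r0 : 0 < 1 / (8 * c) by rewrite divr_gt0//; lra.
apply: (r_convex_of_capped ip_norm) => //.
apply: (capped_of_balls ip_norm) => // c' c'0 c'c d d0.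
have c'lec : c' < c.
  have h : 8 * (1 / (8 * c)) * c' = c' / c by field; lra.
  by move: c'c; rewrite h ltr_pdivrMr// mul1r.
have [e ed He] := frq d d0; exists e => // x y Ox Oy xy.
have e0 : 0 < e by case/andP: ed.
rewrite ratio_gt// in He; apply: subset_trans (delta_modulus_gt He Ox Oy xy).
by move=> z; rewrite /closed_ball_/= => /le_trans; apply; rewrite ler_pM2r ?exprn_gt0// ltW.
Qed.


Lemma limit_of_r_convex Omega r : 0 < r -> closed Omega -> r_convex r Omega ->
  exists l : \bar R,
    ((delta_modulus Omega e / (e ^+ 2)%:E)%E @[e --> 0^'+] --> l)
    /\ ((1 / (8 * r))%:E <= l)%E.
Proof.
move=> r0 clO rO; apply: cvg_of_dichotomy.
  apply/near_right0P; exists (2 * r); first lra.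
  by move=> e; exact: delta_modulus_of_r_convex.
move=> b rb; have b0 : 0 < b by apply: lt_trans rb; rewrite divr_gt0//; lra.
have [h|h] := pselect (\forall e \near 0^'+, (delta_modulus Omega e / (e ^+ 2)%:E <= b%:E)%E).
  by right.
left.
have cO := convex_of_r_convex rO.
have bO : r_convex (1 / (8 * b)) Omega.
  apply: r_convex_of_frequent_balls => // d d0; apply: contrapT => nd; apply: h.
  apply/near_right0P; exists d => // e ed; rewrite leNgt; apply/negP => he.
  by apply: nd; exists e.
have b'0 : 0 < 1 / (8 * b) by rewrite divr_gt0//; lra.
apply/near_right0P; exists (2 * (1 / (8 * b))); first lra.
move=> e ed; have := delta_modulus_of_r_convex b'0 bO ed.
by have -> : 1 / (8 * (1 / (8 * b))) = b by field; lra.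
Qed.

Lemma r_convex_of_limit Omega r (l : \bar R) : 0 < r -> closed Omega -> connected Omega ->
  ((delta_modulus Omega e / (e ^+ 2)%:E)%E @[e --> 0^'+] --> l) ->
  ((1 / (8 * r))%:E <= l)%E -> r_convex r Omega.
Proof.
move=> r0 clO coO cvl hl.
have balls c : 0 < c -> 8 * r * c < 1 -> exists2 d, 0 < d & forall e, 0 < e < d ->
    forall x y, Omega x -> Omega y -> `|x - y| = e ->
      cball (2^-1 *: (x + y)) (c * e ^+ 2) `<=` Omega.
  move=> c0 rc; have cl : (c%:E < l)%E.
    by apply: lt_le_trans hl; rewrite lte_fin ltr_pdivlMr; lra.
  have /near_right0P[d d0 Hd] := cvl _ (open_ereal_gt' cl).
  exists d => // e ed; have e0 : 0 < e by case/andP: ed.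
  by have := Hd e ed; rewrite /= ratio_gt// => /delta_modulus_gt.
have cO : convex_subset Omega.
  pose c := 1 / (16 * r).
  have c0 : 0 < c by rewrite divr_gt0//; lra.
  have [d d0 Hd] : exists2 d, 0 < d & forall e, 0 < e < d ->
    forall x y, Omega x -> Omega y -> `|x - y| = e ->
      cball (2^-1 *: (x + y)) (c * e ^+ 2) `<=` Omega.
    by apply: balls => //; rewrite /c mulrA mulr1 ltr_pdivrMr; lra.
  apply: (convex_of_local_midpoints d0) => // x y Ox Oy xyd.
  have [xy|xy] := eqVneq x y.
    have h2 : 2^-1 + 2^-1 = 1 :> R by lra.
    by rewrite -xy scalerDr -scalerDl h2 scale1r.
  apply: (Hd `|x - y|) Ox Oy erefl _ _.
    by rewrite xyd normr_gt0 subr_eq0 xy.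
  by rewrite /closed_ball_/= subrr normr0 mulr_ge0 ?sqr_ge0// ltW.
apply: (r_convex_of_capped ip_norm) => //.
apply: (capped_of_balls ip_norm) => // c c0 rc d d0.
have [d' d'0 Hd'] := balls c c0 rc.
exists (Num.min d d' / 2).
  have : 0 < Num.min d d' by rewrite lt_min d0.
  have : Num.min d d' <= d by rewrite ge_min lexx.
  by move=> ? ?; apply/andP; split; lra.
apply: Hd'.
have : 0 < Num.min d d' by rewrite lt_min d0.
have : Num.min d d' <= d' by rewrite ge_min lexx orbT.
by move=> ? ?; apply/andP; split; lra.
Qed.

Lemma liminf_of_r_convex Omega r x : 0 < r -> r_convex r Omega -> Omega x ->
  ((1 / (8 * r))%:E <=
    limf_einf (fun e : R => delta_circ ip Omega x e / (e ^+ 2)%:E) (0 : R)^'+)%E.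
Proof.
move=> r0 rO Ox; rewrite limf_einfE.
apply: le_trans (ereal_sup_ubound _); last first.
  exists [set e | 0 < e < 2 * r] => //.
  by apply/near_right0P; exists (2 * r) => //; lra.
apply: le_ereal_inf_tmp => _ [e /= er <-]; have e0 : 0 < e by case/andP: er.
rewrite ratio_ge//; apply: (le_trans _ (le_delta_circ ip e Ox)).
by rewrite -ratio_ge//; exact: delta_modulus_of_r_convex.
Qed.

Lemma r_convex_of_liminf Omega r : 0 < r -> closed Omega -> convex_subset Omega ->
  (forall x, Omega x -> ((1 / (8 * r))%:E <=
    limf_einf (fun e : R => delta_circ ip Omega x e / (e ^+ 2)%:E) (0 : R)^'+)%E) ->
  r_convex r Omega.
Proof.
move=> r0 clO cO hl.
apply: (r_convex_of_capped ip_norm) => //.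
apply: (capped_of_pointwise ip_norm) => // c c0 rc x Ox.
have cl : (c%:E < (1 / (8 * r))%:E)%E by rewrite lte_fin ltr_pdivlMr; lra.
have := lt_le_trans cl (hl x Ox); rewrite limf_einfE.
move=> /ereal_sup_gt[_ [V V0 <-] cV].
have /near_right0P[d d0 dV] : \forall e \near 0^'+, V e by [].
exists d => // y v Oy xyd v1 vxy; have xy0 : 0 < `|x - y| by case/andP: xyd.
apply: (@delta_circ_gt _ _ ip _ _ `|x - y|) => //.
  by rewrite mulr_gt0 ?exprn_gt0.
rewrite -ratio_gt//; apply: lt_le_trans cV _; apply: ereal_inf_lbound.
by exists `|x - y| => //; exact: dV.
Qed.

End Equivalences.

Theorem theorem2p2 (R : realType) (X : completeNormedModType R)
    (ip : {dot X for idfun})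
    (ip_norm : forall u : X, ip u u = `|u| ^+ 2)
    (dimX : dim_ge2 X)
    (r : R) (r_gt0 : 0 < r)
    (Omega : set X) (closedO : closed Omega) (connectedO : connected Omega) :
  let ii := exists l : \bar R,
      ((delta_modulus Omega eps / (eps ^+ 2)%:E)%E @[eps --> 0^'+] --> l)
      /\ ((1 / (8 * r))%:E <= l)%E in
  let iii := convex_set Omega /\
      forall x : X, Omega x ->
        ((1 / (8 * r))%:E <=
          limf_einf (fun eps : R => delta_circ ip Omega x eps / (eps ^+ 2)%:E)
            (0 : R)^'+)%E in
  (r_convex r Omega <-> ii) /\ (r_convex r Omega <-> iii).
Proof.
move=> ii iii; split; split.
- exact: (limit_of_r_convex ip_norm dimX).
- by move=> [l [cvl hl]]; exact: (r_convex_of_limit ip_norm dimX _ _ _ cvl hl).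
- move=> rO; split; first by apply/convex_setE; exact: (convex_of_r_convex rO).
  by move=> x; exact: (liminf_of_r_convex ip_norm).
- move=> [/convex_setE cO hl]; exact: (r_convex_of_liminf ip_norm dimX).
Qed.
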